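(* Let $W=\{(W_i,\upsilon_i)\}_{i\in I}$ be a Bessel fusion sequence for $\mathcal{H}$ with Bessel bound $B_W$, and let $U_1,U_2\in B(\mathcal{H})$ with $\|U_1-U_2\|<\mu$. Let $V=\{(V_i,\upsilon_i)\}_{i\in I}$ and $Z=\{(Z_i,\upsilon_i)\}_{i\in I}$ be fusion frames on $\mathcal{H}$ with upper fusion frame bounds $B_V$ and $B_Z$, respectively, such that $\mathcal{G}_{U_1,W,V}$ is invertible and, for some $\lambda_1,\lambda_2\ge 0$ and $\epsilon>0$, $$\left(\sum_{i\in I}\upsilon_i^2\|\pi_{Z_i}f-\pi_{V_i}f\|^2\right)^{1/2}\le\lambda_1\left(\sum_{i\in I}\upsilon_i^2\|\pi_{Z_i}f\|^2\right)^{1/2}+\lambda_2\left(\sum_{i\in I}\upsilon_i^2\|\pi_{V_i}f\|^2\right)^{1/2}+\epsilon\|f\|$$ for all $f\in\mathcal{H}$. Suppose in addition that $\sum_{i\in I}|\upsilon_i|^2<\infty$ and that, with $B=\max\{B_W,B_V,B_Z\}$, $$\mu+\left(\lambda_1+\lambda_2+\frac{\epsilon}{\sqrt{B}}\right)\left(\sqrt{B}\,\|S_Z^{-1}\|\left(\sum_{i\in I}|\upsilon_i|^2\right)^{1/2}\|U_2\|+\|U_2\|\right)<\frac{\left\|\mathcal{G}_{U_1,W,V}^{-1}\right\|^{-1}}{B\,\|S_V^{-1}\|}.$$ Then $\mathcal{G}_{U_2,W,Z}$ is also invertible.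
   Context: $\mathcal{H}$ is a separable Hilbert space, $I$ a countable index set, $B(\mathcal{H})$ the bounded linear operators on $\mathcal{H}$, and $\pi_X$ the orthogonal projection onto a closed subspace $X$. For closed subspaces $W_i\subseteq\mathcal{H}$, $\left(\sum_{i\in I}\bigoplus W_i\right)_{\ell^2}$ is the Hilbert space of all $\{f_i\}_{i\in I}$ with $f_i\in W_i$, $\sum_i\|f_i\|^2<\infty$, with inner product $\sum_i\langle f_i,g_i\rangle$. A family $W=\{(W_i,\omega_i)\}_{i\in I}$ of closed subspaces with weights $\omega_i>0$ is a fusion frame for $\mathcal{H}$ with bounds $0<A_W\le B_W<\infty$ if $A_W\|f\|^2\le\sum_i\omega_i^2\|\pi_{W_i}f\|^2\le B_W\|f\|^2$ for all $f\in\mathcal{H}$; if only the upper bound is required, $W$ is a Bessel fusion sequence with Bessel bound $B_W$. For a Bessel fusion sequence the synthesis operator is $T_W:\left(\sum_i\bigoplus W_i\right)_{\ell^2}\to\mathcal{H}$, $T_W\{f_i\}=\sum_i\omega_if_i$, with adjoint $T_W^*f=\{\omega_i\pi_{W_i}f\}_{i\in I}$. For a fusion frame, $S_W=T_WT_W^*$ is the (bounded, positive, invertible) fusion frame operator. For a Bessel fusion sequence $X=\{(X_i,x_i)\}_{i\in I}$ and a fusion frame $Y=\{(Y_i,y_i)\}_{i\in I}$, the bounded operator $\phi_{XY}:\left(\sum_i\bigoplus Y_i\right)_{\ell^2}\to\left(\sum_i\bigoplus X_i\right)_{\ell^2}$ is $\phi_{XY}\{f_i\}=\{\pi_{X_i}S_Y^{-1}f_i\}$,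 and for $U\in B(\mathcal{H})$ the $U$-fusion cross Gram matrix is the operator $\mathcal{G}_{U,X,Y}=\phi_{XY}T_Y^*UT_X$ on $\left(\sum_i\bigoplus X_i\right)_{\ell^2}$. *)

(* Defs.v *)
From HB Require Import structures.
From mathcomp Require Import all_boot all_order all_algebra.
From mathcomp Require Import finmap.
From mathcomp Require Import complex ring.
From mathcomp Require Import all_classical all_reals all_analysis.
From mathcomp.analysis.showcase Require summability.

Set Implicit Arguments.
Unset Strict Implicit.
Unset Printing Implicit Defensive.

Import Order.TTheory GRing.Theory Num.Theory.
Import numFieldNormedType.Exports.

Local Open Scope classical_set_scope.
Local Open Scope ring_scope.

Inductive scalars := real_scalars | complex_scalars.

Definition scalar_field (R : realType) (k : scalars) : numFieldType :=
  match k with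
  | real_scalars => R
  | complex_scalars => R[i]
  end.

Definition of_real (R : realType) (k : scalars) : R -> scalar_field R k :=
  match k return R -> scalar_field R k with
  | real_scalars => fun x => x
  | complex_scalars => fun x => x%:C%C
  end.

Definition re_part (R : realType) (k : scalars) : scalar_field R k -> R :=
  match k return scalar_field R k -> R with
  | real_scalars => fun z => z
  | complex_scalars => fun z => complex.Re z
  end.

Definition conj_scalar (R : realType) (k : scalars) :
    scalar_field R k -> scalar_field R k :=
  match k return scalar_field R k -> scalar_field R k with
  | real_scalars => fun z => z
  | complex_scalars => fun z => (z^*)%C
  end.

Arguments of_real {R k} x.
Arguments re_part {R k} z.
Arguments conj_scalar {R k} z.

HB.mixin Record CompleteNormedModule_isHilbert (R : realType) (k : scalars) H
    & CompleteNormedModule (scalar_field R k) H := {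
  inner : H -> H -> scalar_field R k;
  innerP : forall (a : scalar_field R k) (x y z : H),
    inner (a *: x + y) z = a * inner x z + inner y z;
  innerC : forall x y : H, inner y x = conj_scalar (inner x y);
  innerE : forall x : H, inner x x = `|x| ^+ 2
}.

#[short(type="hilbertType")]
HB.structure Definition Hilbert (R : realType) (k : scalars) :=
  {H of CompleteNormedModule (scalar_field R k) H
      & CompleteNormedModule_isHilbert R k H}.

Section scalar_theory.
Context {R : realType} {k : scalars}.
Implicit Types (x y : R) (z : scalar_field R k).

Lemma of_realD x y :
  of_real (x + y) = of_real x + of_real y :> scalar_field R k.
Proof. by case: k => //=; rewrite rmorphD. Qed.

Lemma of_realM x y :
  of_real (x * y) = of_real x * of_real y :> scalar_field R k.
Proof. by case: k => //=; rewrite rmorphM. Qed.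

Lemma of_real0 : of_real 0 = 0 :> scalar_field R k.
Proof. by case: k. Qed.

Lemma of_real_inj : injective (@of_real R k).
Proof. by case: k => //= x y []. Qed.

Lemma ler_of_real x y : (of_real x <= of_real y :> scalar_field R k) = (x <= y).
Proof. by case: k => //=; rewrite lecR. Qed.

Lemma re_partK z : 0 <= z -> of_real (re_part z) = z.
Proof. by case: k z => //= z z0; rewrite RRe_real// ger0_real. Qed.

End scalar_theory.

(* The library norm [`|x|] is scalar-valued; [nrm x] is the same nonnegative
   number as an element of [R]. *)
Definition nrm (R : realType) (k : scalars)
    (E : normedModType (scalar_field R k)) (x : E) : R := re_part `|x|.

Section nrm_theory.
Context {R : realType} {k : scalars} {E : normedModType (scalar_field R k)}.
Implicit Types x y : E.

Lemma nrmE x : of_real (nrm x) = `|x|.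
Proof. exact: re_partK. Qed.

Lemma nrm_ge0 x : 0 <= nrm x.
Proof. by rewrite -(@ler_of_real R k) nrmE of_real0. Qed.

Lemma nrmD x y : nrm (x + y) <= nrm x + nrm y.
Proof. by rewrite -(@ler_of_real R k) of_realD !nrmE ler_normD. Qed.

Lemma nrmZ (a : scalar_field R k) x : nrm (a *: x) = re_part `|a| * nrm x.
Proof.
by apply: (@of_real_inj R k); rewrite of_realM !nrmE re_partK// normrZ.
Qed.

Lemma nrm0_eq0 x : nrm x = 0 -> x = 0.
Proof. by move=> x0; apply/normr0_eq0; rewrite -nrmE x0 of_real0. Qed.

Lemma nrm0 : nrm (0 : E) = 0.
Proof. by apply: (@of_real_inj R k); rewrite nrmE normr0 of_real0. Qed.

End nrm_theory.

Record closed_subspace (R : realType) (k : scalars) (H : hilbertType R k) :=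
  ClosedSubspace {
    subspace_set :> set H;
    subspace0 : subspace_set 0;
    subspaceP : forall (a : scalar_field R k) (x y : H),
      subspace_set x -> subspace_set y -> subspace_set (a *: x + y);
    subspace_closed : closed subspace_set }.

Section ell2_sum.
Context {R : realType} {k : scalars} {H : hilbertType R k} {I : countType}.
Implicit Types (X : I -> closed_subspace H) (f g : I -> H).
Local Open Scope ereal_scope.

Definition sumsq f : \bar R := \esum_(i in [set: I]) (nrm (f i) ^+ 2)%:E.

Definition in_ell2 X : {pred I -> H} :=
  fun f => `[< (forall i, subspace_set (X i) (f i)) /\ sumsq f < +oo >].

Record ell2 X := Ell2 { ell2_fun :> I -> H; _ : ell2_fun \in in_ell2 X }.

HB.instance Definition _ X := [isSub for @ell2_fun X].
HB.instance Definition _ X := [Choice of ell2 X by <:].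

Lemma in_ell2P X f : f \in in_ell2 X <->
  (forall i, subspace_set (X i) (f i)) /\ sumsq f < +oo.
Proof. by split=> [/asboolP|?]//; exact/asboolP. Qed.

Lemma sumsq_ge0 f : 0 <= sumsq f.
Proof. by apply: esum_ge0 => i _; rewrite lee_fin sqr_ge0. Qed.

Lemma sumsqZ_le (a : scalar_field R k) f :
  sumsq (a *: f) <= ((re_part `|a|) ^+ 2)%:E * sumsq f.
Proof.
apply: ge_ereal_sup => _ [F [finF _] <-].
rewrite (_ : \sum_(i \in F) _ =
  ((re_part `|a|) ^+ 2)%:E * \sum_(i \in F) (nrm (f i) ^+ 2)%:E); last first.
  rewrite ge0_mule_fsumr; last by move=> i; rewrite lee_fin sqr_ge0.
  by apply: eq_fsbigr => i _; rewrite nrmZ exprMn EFinM.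
apply: lee_wpmul2l; first by rewrite lee_fin sqr_ge0.
by apply: ereal_sup_ubound; exists F.
Qed.

(* Weighted form of (a + b)^2 <= (1 + c) a^2 + (1 + 1/c) b^2, from which both
   closure under sums and the triangle inequality follow. *)
Lemma sumsqD_le (c : R) f g : (0 < c)%R ->
  sumsq (f + g)%R <= (1 + c)%:E * sumsq f + (1 + c^-1)%:E * sumsq g.
Proof.
move=> c0; apply: ge_ereal_sup => _ [F [finF _] <-].
apply: (@le_trans _ _ ((1 + c)%:E * \sum_(i \in F) (nrm (f i) ^+ 2)%:E +
  (1 + c^-1)%:E * \sum_(i \in F) (nrm (g i) ^+ 2)%:E)); last first.
  have c1 : (0 <= 1 + c)%R by rewrite addr_ge0// ltW.
  have c2 : (0 <= 1 + c^-1)%R by rewrite addr_ge0// invr_ge0 ltW.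
  by apply: leeD; apply: lee_wpmul2l; rewrite ?lee_fin//;
    apply: ereal_sup_ubound; exists F.
rewrite !fsbig_finite//= !sumEFin -!EFinM -EFinD lee_fin.
rewrite !mulr_sumr -big_split/=; apply: ler_sum => i _.
set a := nrm (f i); set b := nrm (g i).
apply: (@le_trans _ _ ((a + b) ^+ 2)%R).
  by rewrite lerXn2r ?nnegrE ?addr_ge0 ?nrm_ge0// nrmD.
rewrite -subr_ge0 [leRHS](_ : _ = (c^-1 * (c * a - b) ^+ 2)%R); last first.
  by field; rewrite gt_eqF.
by rewrite mulr_ge0// ?invr_ge0 ?sqr_ge0// ltW.
Qed.

Lemma in_ell2_submod X : submod_closed (in_ell2 X).
Proof.
split.
  apply/in_ell2P; split=> [i|]; first exact: subspace0.
  by rewrite /sumsq esum1// => i _; rewrite nrm0 expr0n.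
move=> a f g /in_ell2P[Xf sf] /in_ell2P[Xg sg].
apply/in_ell2P; split=> [i|]; first exact: subspaceP.
apply: (le_lt_trans (sumsqD_le _ _ ltr01)).
have fin h (c : R) : (0 <= c)%R -> sumsq h < +oo -> c%:E * sumsq h < +oo.
  by move=> c0 hoo; rewrite lte_mul_pinfty.
rewrite lte_add_pinfty// fin// ?addr_ge0 ?invr_ge0//.
by apply: (le_lt_trans (sumsqZ_le _ _)); rewrite fin// sqr_ge0.
Qed.

HB.instance Definition _ X :=
  GRing.isSubmodClosed.Build _ _ (in_ell2 X) (in_ell2_submod X).
HB.instance Definition _ X := [SubChoice_isSubLmodule of ell2 X by <:].

(* The norm induced by the inner product sum_i <f_i, g_i>. *)
Definition ell2_norm X (f : ell2 X) : R := Num.sqrt (fine (sumsq f)).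

Lemma ell2_sub X (f : ell2 X) i : subspace_set (X i) (f i).
Proof. by have /in_ell2P[] := valP f. Qed.

Lemma sumsqE X (f : ell2 X) : sumsq f = (ell2_norm f ^+ 2)%:E.
Proof.
have /in_ell2P[_ ffin] := valP f.
by rewrite sqr_sqrtr ?fine_ge0 ?sumsq_ge0// fineK// ge0_fin_numE ?sumsq_ge0.
Qed.

Lemma ell2_norm_le X (f : ell2 X) (c : R) : (0 <= c)%R ->
  (ell2_norm f <= c)%R = (sumsq f <= (c ^+ 2)%:E).
Proof.
by move=> c0; rewrite sumsqE lee_fin ler_sqr// nnegrE sqrtr_ge0.
Qed.

Lemma ell2_norm_eq0 X (f : ell2 X) : ell2_norm f = 0%R -> f = 0%R.
Proof.
move=> f0; apply: val_inj; apply/funext => i /=; apply: nrm0_eq0.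
have : (nrm (f i) ^+ 2)%:E <= sumsq f.
  by apply: esum_ge; exists [set i]; [split|rewrite fsbig_set1].
rewrite sumsqE f0 expr0n lee_fin => fi0.
by apply/eqP; rewrite -sqrf_eq0 eq_le fi0 sqr_ge0.
Qed.

Lemma ell2_normD X (f g : ell2 X) :
  (ell2_norm (f + g) <= ell2_norm f + ell2_norm g)%R.
Proof.
set s := ell2_norm f; set r := ell2_norm g.
have s0 : (0 <= s)%R by exact: sqrtr_ge0.
have r0 : (0 <= r)%R by exact: sqrtr_ge0.
have [/ell2_norm_eq0 f0|sN0] := eqVneq s 0%R.
  by rewrite f0 add0r lerDr.
have [/ell2_norm_eq0 g0|rN0] := eqVneq r 0%R.
  by rewrite g0 addr0 lerDl.
have sp : (0 < s)%R by rewrite lt_def sN0.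
have rp : (0 < r)%R by rewrite lt_def rN0.
rewrite ell2_norm_le ?addr_ge0// GRing.valD.
apply: (le_trans (sumsqD_le f g (divr_gt0 rp sp))).
rewrite !sumsqE -/s -/r -!EFinM -EFinD lee_fin le_eqVlt; apply/orP; left.
by apply/eqP; field; rewrite sN0 rN0.
Qed.

Lemma ell2_normZ_le X (a : scalar_field R k) (f : ell2 X) :
  (ell2_norm (a *: f) <= re_part `|a| * ell2_norm f)%R.
Proof.
have a0 : (0 <= re_part `|a|)%R := @nrm_ge0 R k (scalar_field R k)^o a.
rewrite ell2_norm_le; last by rewrite mulr_ge0// sqrtr_ge0.
rewrite GRing.valZ (le_trans (sumsqZ_le _ _))//.
by rewrite sumsqE -EFinM exprMn.
Qed.

End ell2_sum.

Section ell2_normed.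
Context {R : realType} {k : scalars} {H : hilbertType R k} {I : countType}.
Variable X : I -> closed_subspace H.
Implicit Types f g : ell2 X.

Let nm f : scalar_field R k := of_real (ell2_norm f).

Let nmD f g : nm (f + g) <= nm f + nm g.
Proof. by rewrite -of_realD ler_of_real ell2_normD. Qed.

Let nmZ (a : scalar_field R k) f : nm (a *: f) = `|a| * nm f.
Proof.
have le b h : nm (b *: h) <= `|b| * nm h.
  by rewrite -(re_partK (normr_ge0 b)) -of_realM ler_of_real ell2_normZ_le.
apply/eqP; rewrite eq_le le/=.
have [->|a0] := eqVneq a 0.
  by rewrite normr0 mul0r -of_real0 ler_of_real sqrtr_ge0.
rewrite -[in leLHS](scale1r f) -(mulVf a0) -scalerA.
apply: (le_trans (ler_wpM2l (normr_ge0 a) (le _ _))).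
by rewrite mulrA -normrM mulfV// normr1 mul1r.
Qed.

Let nm_eq0 f : nm f = 0 -> f = 0.
Proof.
by rewrite /nm -of_real0 => /of_real_inj f0; exact: ell2_norm_eq0.
Qed.

HB.instance Definition _ :=
  Lmodule_isNormed.Build (scalar_field R k) (ell2 X) nmD nmZ nm_eq0.

Lemma nrm_ell2 f : nrm f = ell2_norm f.
Proof. by apply: (@of_real_inj R k); rewrite nrmE. Qed.

End ell2_normed.

Section operators.
Context {R : realType} {k : scalars}.

Definition bounded_operator (E F : normedModType (scalar_field R k))
    (T : E -> F) : Prop :=
  linear T /\ continuous T.

(* Meaningful for bounded operators: the supremum of an unbounded set is 0. *)
Definition opnorm (E F : normedModType (scalar_field R k)) (T : E -> F) : R :=
  sup [set nrm (T x) | x in [set x : E | nrm x <= 1]].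

Definition invertible_operator (E F : normedModType (scalar_field R k))
    (T : E -> F) : Prop :=
  bounded_operator T /\
  exists S : F -> E, [/\ bounded_operator S, cancel T S & cancel S T].

(* The inverse map of [T] when [T] is bijective. *)
Definition opinv (E F : normedModType (scalar_field R k))
    (T : E -> F) : F -> E :=
  fun y => xget 0 [set x | T x = y].

End operators.

Unset Implicit Arguments.

Section fusion.
Context {R : realType} {k : scalars} {H : hilbertType R k} {I : countType}.
Implicit Types (X Y : I -> closed_subspace H) (w x y : I -> R).

(* Sum of a family of nonnegative reals; it is 0 if the sum is infinite. *)
Definition rsum (a : I -> R) : R := fine (\esum_(i in [set: I]) (a i)%:E)%E.

Definition orth_proj (X : closed_subspace H) (f : H) : H :=
  xget 0 [set g | subspace_set X g /\
                  forall h, subspace_set X h -> inner (f - g) h = 0].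

Definition bessel_fusion X x (B : R) : Prop :=
  (forall i, 0 < x i) /\
  forall f : H,
    (\esum_(i in [set: I]) (x i ^+ 2 * nrm (orth_proj (X i) f) ^+ 2)%:E
     <= (B * nrm f ^+ 2)%:E)%E.

Definition fusion_frame X x (A B : R) : Prop :=
  [/\ 0 < A, A <= B, bessel_fusion X x B &
  forall f : H, ((A * nrm f ^+ 2)%:E <=
     \esum_(i in [set: I]) (x i ^+ 2 * nrm (orth_proj (X i) f) ^+ 2)%:E)%E].

(* An unconditional sum: [summability.sum] is the limit of the net of partial
   sums over finite subsets of [I]. *)
Definition synthesis_op X x (f : ell2 X) : H :=
  summability.sum (fun i => of_real (x i) *: f i).

(* In [analysis_op] and [phi_op], [insubd 0] casts a family of vectors to the
   direct sum; its default 0 is not reached when [X], respectively [Y], is a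
   Bessel fusion sequence, respectively a fusion frame. [analysis_op X x] is
   the adjoint of [synthesis_op X x]. *)
Definition analysis_op X x (f : H) : ell2 X :=
  insubd 0 (fun i => of_real (x i) *: orth_proj (X i) f).

Definition frame_operator X x : H -> H :=
  fun f => synthesis_op X x (analysis_op X x f).

Definition phi_op X Y y (f : ell2 Y) : ell2 X :=
  insubd 0 (fun i => orth_proj (X i) (opinv (frame_operator Y y) (f i))).

Definition cross_gram (U : H -> H) X x Y y : ell2 X -> ell2 X :=
  fun f => phi_op X Y y (analysis_op Y y (U (synthesis_op X x f))).

End fusion.

(* Main.v *)
Require Import Defs.
From mathcomp Require Import all_boot all_order all_algebra.
From mathcomp Require Import finmap complex ring lra.
From mathcomp Require Import all_classical all_reals all_analysis.

(* Both Gram operators factor through [H]: with [T = T_W],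
   [G_(U1,W,V) = A1 T] and [G_(U2,W,Z) = A2 T], where
   [A1 = phi_WV T_V^* U1] and [A2 = phi_WZ T_Z^* U2] map [H] into the direct
   sum of the [W_i].
   Splitting
     S_V^-1 pi_Vi U1 - S_Z^-1 pi_Zi U2
       = S_V^-1 pi_Vi (U1 - U2) + S_V^-1 (pi_Vi - pi_Zi) U2
         + S_V^-1 (S_Z - S_V) S_Z^-1 pi_Zi U2
   and bounding the three terms by the Bessel inequality, the perturbation
   hypothesis, and Cauchy-Schwarz against the square-summable weights shows that
   [|A1 - A2|] is at most [sqrt B |S_V^-1|] times the left-hand side of the
   smallness hypothesis.  Hence [|G_(U1,W,V)^-1| |A1 - A2| |T| < 1], and
   [G_(U2,W,Z) = G_(U1,W,V) - (A1 - A2) T] is invertible by a Neumann series. *)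

Import Order.TTheory GRing.Theory Num.Theory.
Import numFieldNormedType.Exports.

Set Implicit Arguments.
Unset Strict Implicit.
Unset Printing Implicit Defensive.

Local Open Scope classical_set_scope.
Local Open Scope ring_scope.

(** * Real parts of scalars, uniformly over the real and complex cases *)

Section scalar_real_part.
Context {R : realType} {k : scalars}.
Implicit Types (a : R) (z w : scalar_field R k).

Lemma re_partD z w : re_part (z + w) = re_part z + re_part w.
Proof. by case: k z w => //= -[a b] [c d]. Qed.

Lemma re_partMr a z : re_part (of_real a * z) = a * re_part z.
Proof. by case: k z => //= -[c d] /=; rewrite mul0r subr0. Qed.

Lemma re_part_of_real a : re_part (of_real a : scalar_field R k) = a.
Proof. by case: k. Qed.

Lemma re_part_conj z : re_part (conj_scalar z) = re_part z.
Proof. by case: k z => //= -[c d]. Qed.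

(** The real part of [conj z * z] is [|z|^2], a sum of squares in the complex case; this detects
    zero scalars from real parts alone. *)
Lemma re_part_conjM z : re_part (conj_scalar z * z) = 0 -> z = 0.
Proof.
case: k z => /= [z /eqP|[c d] /= /eqP];
  first by rewrite mulf_eq0 => /orP[] /eqP.
rewrite mulNr opprK -!expr2 paddr_eq0 ?sqr_ge0// !sqrf_eq0.
by move=> /andP[/eqP-> /eqP->].
Qed.

Lemma of_real1 : of_real 1 = 1 :> scalar_field R k.
Proof. by case: k. Qed.

Lemma of_realN a : of_real (- a) = - of_real a :> scalar_field R k.
Proof. by case: k => //=; rewrite rmorphN. Qed.

Lemma norm_of_real a : `|of_real a : scalar_field R k| = of_real `|a|.
Proof. by case: k => //=; rewrite normc_def /= expr0n addr0 sqrtr_sqr. Qed.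

End scalar_real_part.

(** * Elementary rules for the real-valued norm *)

Section nrm_lemmas.
Context {R : realType} {k : scalars} {E : normedModType (scalar_field R k)}.
Implicit Types (a : R) (x y : E).

Lemma nrmN x : nrm (- x) = nrm x.
Proof. by rewrite /nrm normrN. Qed.

Lemma nrmB x y : nrm (x - y) <= nrm x + nrm y.
Proof. by rewrite -(nrmN y) nrmD. Qed.

Lemma nrmBC x y : nrm (x - y) = nrm (y - x).
Proof. by rewrite -nrmN opprB. Qed.

Lemma nrmZr a x : nrm (of_real a *: x) = `|a| * nrm x.
Proof. by rewrite nrmZ norm_of_real re_part_of_real. Qed.

Lemma nrm_lt x (e : scalar_field R k) :
  0 < e -> (`|x| < e) = (nrm x < re_part e).
Proof.
move=> e0; rewrite -(nrmE x) -{1}(re_partK (ltW e0)).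
by rewrite !lt_neqAle ler_of_real (inj_eq (@of_real_inj R k)).
Qed.

Lemma re_part_gt0 (e : scalar_field R k) : 0 < e -> 0 < re_part e.
Proof.
by move=> e0; rewrite -[X in X < _](@nrm0 R k E) -nrm_lt// normr0.
Qed.

End nrm_lemmas.

(** * The real inner product underlying a Hilbert space *)

Section real_inner.
Context {R : realType} {k : scalars} {H : hilbertType R k}.
Implicit Types (a : R) (x y z : H).

(** The real part suffices for norms and Cauchy-Schwarz, and lets the estimates take place in the
    ordered field [R] without a case split on the scalars. *)
Definition rin x y : R := re_part (inner x y).

Lemma innerDl x y z : inner (x + y) z = inner x z + inner y z.
Proof. by rewrite -[x]scale1r innerP mul1r scale1r. Qed.

Lemma inner0l z : inner 0 z = 0.
Proof. by apply: (@addrI _ (inner 0 z)); rewrite -innerDl !addr0. Qed.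

Lemma innerZl c x z : inner (c *: x) z = c * inner x z.
Proof. by rewrite -[c *: x]addr0 innerP inner0l addr0. Qed.

Lemma rinC x y : rin x y = rin y x.
Proof. by rewrite /rin (innerC y x) re_part_conj. Qed.

Lemma rinDl x y z : rin (x + y) z = rin x z + rin y z.
Proof. by rewrite /rin innerDl re_partD. Qed.

Lemma rinDr x y z : rin z (x + y) = rin z x + rin z y.
Proof. by rewrite rinC rinDl !(rinC z). Qed.

Lemma rinZl a x z : rin (of_real a *: x) z = a * rin x z.
Proof. by rewrite /rin innerZl re_partMr. Qed.

Lemma rinZr a x z : rin z (of_real a *: x) = a * rin z x.
Proof. by rewrite rinC rinZl rinC. Qed.

Lemma rin0l z : rin 0 z = 0.
Proof. by rewrite -(scale0r z) -of_real0 rinZl mul0r. Qed.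

Lemma rinNl x z : rin (- x) z = - rin x z.
Proof. by rewrite -scaleN1r -of_real1 -of_realN rinZl mulN1r. Qed.

Lemma rinNr x z : rin z (- x) = - rin z x.
Proof. by rewrite rinC rinNl rinC. Qed.

Lemma rin_suml (J : choiceType) (A : seq J) (f : J -> H) z :
  rin (\sum_(i <- A) f i) z = \sum_(i <- A) rin (f i) z.
Proof.
by elim/big_rec2: _ => [|i a b _ <-]; rewrite ?rin0l// rinDl.
Qed.

Lemma rinxx x : rin x x = nrm x ^+ 2.
Proof. by rewrite /rin innerE -nrmE expr2 re_partMr re_part_of_real. Qed.

Lemma nrm_sqrD x y : nrm (x + y) ^+ 2 = nrm x ^+ 2 + 2 * rin x y + nrm y ^+ 2.
Proof. by rewrite -!rinxx rinDl !rinDr (rinC y x); ring. Qed.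

Lemma nrm_sqrB x y : nrm (x - y) ^+ 2 = nrm x ^+ 2 - 2 * rin x y + nrm y ^+ 2.
Proof. by rewrite nrm_sqrD nrmN rinNr; ring. Qed.

(** Cauchy-Schwarz comes from squaring the triangle inequality, which the normed structure already
    supplies, and expanding. *)
Lemma rin_le x y : rin x y <= nrm x * nrm y.
Proof.
have : nrm (x + y) ^+ 2 <= (nrm x + nrm y) ^+ 2.
  by rewrite lerXn2r ?nnegrE ?addr_ge0 ?nrm_ge0// nrmD.
by rewrite nrm_sqrD; lra.
Qed.

Lemma nrm_le_of_sqr x (c : R) : 0 <= c ->
  (nrm x ^+ 2 <= c * nrm x) -> nrm x <= c.
Proof.
move=> c0; have [->//|x0] := eqVneq (nrm x) 0.
by rewrite expr2 ler_pM2r// lt_def x0 nrm_ge0.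
Qed.

(** Since [X] is stable under scalars, [h] may be multiplied by the conjugate of [inner h z]; the
    real part is then the squared modulus of that scalar. *)
Lemma inner_eq0_rin (X : closed_subspace H) z :
  (forall h, subspace_set X h -> rin z h = 0) ->
  forall h, subspace_set X h -> inner z h = 0.
Proof.
move=> zX h Xh; set c := inner h z.
suff : c = 0.
  by rewrite innerC -/c => ->; case: (k) => //=; rewrite /conjc oppr0.
apply: re_part_conjM.
have /(zX _) : subspace_set X (conj_scalar c *: h + 0).
  by apply: subspaceP => //; exact: subspace0.
by rewrite addr0 rinC /rin innerZl.
Qed.

End real_inner.

(** * Convergence and completeness in terms of the real-valued norm *)

Section nrm_limits.
Context {R : realType} {k : scalars}.

Lemma ball_nrm (E : normedModType (scalar_field R k)) (x : E)
    (e : scalar_field R k) :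
  0 < e -> ball x e = [set y | nrm (x - y) < re_part e].
Proof.
by move=> e0; rewrite -ball_normE; apply/seteqP; split=> y /=; rewrite nrm_lt.
Qed.

Lemma of_real_gt0 (e : R) : 0 < e -> 0 < of_real e :> scalar_field R k.
Proof.
by rewrite !lt_neqAle -(of_real0 (R := R) (k := k))
  ler_of_real (inj_eq (@of_real_inj R k)).
Qed.

Lemma cvg_nrmP (E : normedModType (scalar_field R k)) (F : set_system E)
    {FF : Filter F} (l : E) :
  F --> l <-> forall e : R, 0 < e -> F [set y | nrm (l - y) < e].
Proof.
split=> [/cvg_ballP Fl e e0|Fl].
  have := Fl _ (of_real_gt0 e0); rewrite near_simpl /= => H.
  by move: H; rewrite ball_nrm ?of_real_gt0// re_part_of_real.
apply/cvg_ballP => e e0; rewrite ball_nrm//; apply: Fl.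
exact: (re_part_gt0 (E := E)).
Qed.

(** Neumann iterates, nearest points and unconditional sums all obtain their limits from this form
    of completeness. *)
Lemma cauchy_nrm (E : completeNormedModType (scalar_field R k))
    (F : set_system E) {FF : ProperFilter F} :
  (forall e : R, 0 < e -> exists x, F [set y | nrm (x - y) < e]) ->
  exists l, forall e : R, 0 < e -> F [set y | nrm (l - y) < e].
Proof.
move=> cF; have /cauchy_cvgP cvF : cauchy F.
  apply: cauchy_exP => e e0.
  have [x Fx] := cF _ (re_part_gt0 (E := E) e0).
  by exists x; rewrite ball_nrm.
by exists (lim F); apply/cvg_nrmP.
Qed.

End nrm_limits.

(** * Linear operators, norm bounds and the operator norm *)

Section bounded_operators.
Context {R : realType} {k : scalars}.
Implicit Types E F : normedModType (scalar_field R k).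

Lemma lin0 E F (T : E -> F) : linear T -> T 0 = 0.
Proof.
by move=> lT; have := lT (-1) 0 0; rewrite scaler0 addr0 scaleN1r addNr.
Qed.

Lemma linB E F (T : E -> F) : linear T -> {morph T : x y / x - y}.
Proof.
by move=> lT x y; rewrite addrC -scaleN1r lT scaleN1r addrC.
Qed.

Lemma linD E F (T : E -> F) : linear T -> {morph T : x y / x + y}.
Proof. by move=> lT x y; rewrite -[x]scale1r lT !scale1r. Qed.

Lemma linZ E F (T : E -> F) : linear T -> forall a x, T (a *: x) = a *: T x.
Proof. by move=> lT a x; rewrite -[a *: x]addr0 lT lin0// addr0. Qed.

Definition nrm_bound E F (T : E -> F) (M : R) :=
  forall x, nrm (T x) <= M * nrm x.

Lemma bound_continuous E F (T : E -> F) (M : R) :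
  linear T -> nrm_bound T M -> continuous T.
Proof.
move=> lT bT x; apply/cvg_nrmP => e e0.
(* No sign is assumed for [M]; [|M| + 1] is a positive upper bound by which one can divide. *)
have M1 : 0 < `|M| + 1 by rewrite ltr_wpDl.
change (nbhs x [set y | nrm (T x - T y) < e]).
have near_x : nbhs x [set y | nrm (x - y) < e / (`|M| + 1)].
  have /cvg_nrmP : nbhs x --> x by exact: cvg_id.
  by apply; rewrite divr_gt0.
apply: filterS near_x => y /=; rewrite ltr_pdivlMr// => xy.
rewrite -(linB lT); apply: le_lt_trans xy; apply: (le_trans (bT _)).
rewrite mulrC ler_wpM2l ?nrm_ge0//.
by rewrite (le_trans (ler_norm _))// lerDl.
Qed.

Lemma continuous_bound E F (T : E -> F) : linear T -> continuous T ->
  exists2 M, 0 <= M & nrm_bound T M.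
Proof.
move=> lT cT.
have /cvg_nrmP/(_ 1 ltr01) := cT 0.
move=> /nbhs_ballP[e /= e0].
rewrite ball_nrm// => eT.
(* Half the radius, so that a vector rescaled to norm [d] lies strictly inside the open ball. *)
pose d := re_part e / 2.
have e0' : 0 < re_part e := re_part_gt0 (E := E) e0.
have d0 : 0 < d by rewrite divr_gt0.
exists d^-1 => [|x]; first by rewrite invr_ge0 ltW.
have [x0|xN0] := eqVneq (nrm x) 0.
  by rewrite (nrm0_eq0 x0) lin0// !nrm0 mulr0.
have xp : 0 < nrm x by rewrite lt_def xN0 nrm_ge0.
have := eT (of_real (d / nrm x) *: x); rewrite /= sub0r nrmN nrmZr ger0_norm;
  last by rewrite ltW// divr_gt0.
rewrite divfK// lin0// sub0r nrmN linZ// nrmZr ger0_norm; last first.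
  by rewrite ltW// divr_gt0.
have -> : d < re_part e by rewrite /d; lra.
move=> /(_ isT) /ltW; rewrite mulrAC ler_pdivrMr// mul1r => h.
by rewrite ler_pdivlMl.
Qed.

(** The bound [M] makes the set under the supremum bounded, so that [sup] is a true least upper
    bound and not its default 0. *)
Lemma opnorm_ub E F (T : E -> F) (M : R) (x : E) : nrm_bound T M ->
  nrm x <= 1 -> nrm (T x) <= opnorm T.
Proof.
move=> bT x1; apply: ub_le_sup; last by exists x.
exists (`|M|) => _ [y /= y1 <-]; apply: (le_trans (bT y)).
apply: (@le_trans _ _ (`|M| * nrm y)).
  by rewrite ler_wpM2r ?nrm_ge0// ler_norm.
by rewrite -[leRHS]mulr1 ler_wpM2l.
Qed.

Lemma opnorm_ge0 E F (T : E -> F) (M : R) : nrm_bound T M -> 0 <= opnorm T.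
Proof.
move=> bT; have := @opnorm_ub _ _ T M 0 bT.
by rewrite nrm0 ler01 => /(_ isT); apply: le_trans; exact: nrm_ge0.
Qed.

Lemma opnorm_bound E F (T : E -> F) (M : R) : linear T -> nrm_bound T M ->
  nrm_bound T (opnorm T).
Proof.
move=> lT bT x; have [x0|xN0] := eqVneq (nrm x) 0.
  by rewrite (nrm0_eq0 x0) lin0// !nrm0 mulr0.
have xp : 0 < nrm x by rewrite lt_def xN0 nrm_ge0.
have := opnorm_ub (x := of_real (nrm x)^-1 *: x) bT.
rewrite linZ// !nrmZr ger0_norm ?invr_ge0 ?nrm_ge0// mulVf// lexx => /(_ isT).
by rewrite ler_pdivrMl// mulrC.
Qed.

Lemma opinvE E F (T : E -> F) (S : F -> E) :
  cancel T S -> cancel S T -> opinv T = S.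
Proof.
move=> TS ST; apply/funext => y; rewrite /opinv.
by case: xgetP => [x _ /= <-|/(_ (S y))]; rewrite ?TS//= ST.
Qed.

End bounded_operators.

(** * Inversion of [1 - K] for a contraction [K] *)

Section neumann.
Context {R : realType} {k : scalars}.
Context {E : completeNormedModType (scalar_field R k)}.

Lemma geometric_lt (C q e : R) : 0 <= q < 1 -> 0 < e ->
  exists n, C * q ^+ n < e.
Proof.
move=> /andP[q0 q1] e0.
have /cvgrPdist_lt/(_ e e0) : C * q ^+ n @[n --> \oo] --> (0 : R).
  by rewrite -(mulr0 C); apply: cvgM; [exact: cvg_cst|apply: cvg_expr;
    rewrite ger0_norm].
move=> [n _ /(_ n (leqnn n))] /=; rewrite sub0r normrN => h.
by exists n; apply: le_lt_trans h; rewrite ler_norm.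
Qed.

(** The partial sums of the Neumann series are the iterates of [x |-> y + K x] from 0; they are
    Cauchy at a geometric rate and their limit is the solution. *)
Lemma neumann_surj (K : E -> E) (q : R) : linear K -> 0 <= q < 1 ->
  nrm_bound K q -> forall y, exists x, x - K x = y.
Proof.
move=> lK q01 bK y; have /andP[q0 q1] := q01.
have q1' : 0 < 1 - q by rewrite subr_gt0.
pose u n := iter n (fun x => y + K x) 0.
(* [C] is the fixed point of [t |-> nrm y + q * t], hence an invariant bound for the iterates. *)
pose C := nrm y / (1 - q).
have uC n : nrm (u n) <= C.
  elim: n => [|n IH] /=; first by rewrite nrm0 divr_ge0 ?nrm_ge0// ltW.
  have -> : C = nrm y + q * C by rewrite /C; field; rewrite gt_eqF.
  rewrite (le_trans (nrmD _ _))// lerD2l (le_trans (bK _))//.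
  by rewrite ler_wpM2l.
(* Each step applies [K] to the previous difference, so [n] steps gain [q ^+ n] over [u 0 - u m],
   which is [- u m]. *)
have uq n m : nrm (u n - u (m + n)%N) <= C * q ^+ n.
  elim: n => [|n IH]; first by rewrite addn0 mulr1 /= sub0r nrmN.
  rewrite addnS /= opprD addrACA subrr add0r -(linB lK) exprS mulrCA.
  by rewrite (le_trans (bK _))// ler_wpM2l.
have [l ul] : exists l, forall e, 0 < e ->
    (u n @[n --> \oo]) [set z | nrm (l - z) < e].
  apply: cauchy_nrm => e e0; have [n Cn] := geometric_lt C q01 e0.
  exists (u n); exists n => // m /= nm.
  by apply: le_lt_trans Cn; rewrite -(subnK nm).
exists l; apply/eqP; rewrite -subr_eq0; apply/eqP; apply: nrm0_eq0.
apply/eqP; rewrite eq_le nrm_ge0 andbT.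
apply/ler_addgt0Pr => e e0; rewrite add0r.
have [n _ un] := ul _ (divr_gt0 e0 (ltr0Sn R 1)).
(* The recursion [u n.+1 = y + K (u n)] turns the residual into two approximation errors. *)
have -> : l - K l - y = (l - u n.+1) - K (l - u n).
  by rewrite (linB lK) /= opprB opprD !addrA subrK addrAC.
rewrite (le_trans (nrmB _ _))//.
have un1 : nrm (l - u n.+1) < e / 2 := un n.+1 (leqnSn n).
have un0 : nrm (l - u n) < e / 2 := un n (leqnn n).
have := bK (l - u n).
have : q * nrm (l - u n) <= nrm (l - u n).
  by rewrite -[leRHS]mul1r ler_wpM2r ?nrm_ge0// ltW.
by lra.
Qed.

(** The lower bound [(1 - q) |x| <= |x - K x|] yields both injectivity and the norm of the inverse;
    linearity of the chosen preimages follows from injectivity. *)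
Lemma neumann_inverse (K : E -> E) (q : R) : linear K -> 0 <= q < 1 ->
    nrm_bound K q ->
  exists L : E -> E, [/\ linear L, nrm_bound L (1 - q)^-1,
    forall x, L (x - K x) = x & forall y, L y - K (L y) = y].
Proof.
move=> lK q01 bK; have /andP[q0 q1] := q01.
have q1' : 0 < 1 - q by rewrite subr_gt0.
have [L KL] := choice (neumann_surj lK q01 bK).
have low x : (1 - q) * nrm x <= nrm (x - K x).
  have := bK x; have := nrmD (x - K x) (K x); rewrite subrK; lra.
have inj x y : x - K x = y - K y -> x = y.
  move=> xy; apply/eqP; rewrite -subr_eq0; apply/eqP/nrm0_eq0/eqP.
  rewrite eq_le nrm_ge0 andbT.
  have := low (x - y); rewrite (linB lK) opprB.
  have -> : x - y + (K y - K x) = (x - K x) - (y - K y).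
    by rewrite opprB [LHS]addrACA [RHS]addrACA (addrC (- y)).
  by rewrite xy subrr nrm0 pmulr_rle0.
have LK x : L (x - K x) = x by apply: inj; rewrite KL.
exists L; split=> // [a x y|y].
  by apply: inj; rewrite KL lK opprD addrACA -scalerBr !KL.
by rewrite ler_pdivlMl// -[in leRHS](KL y).
Qed.

End neumann.

(** * Existence and properties of orthogonal projections *)

Section projection.
Context {R : realType} {k : scalars} {H : hilbertType R k}.
Variable X : closed_subspace H.
Implicit Types f g h : H.

Let inX := subspace_set X.

Lemma subspaceD f g : inX f -> inX g -> inX (f + g).
Proof. by move=> Xf Xg; rewrite -[f]scale1r; exact: subspaceP. Qed.

Lemma subspaceZ c f : inX f -> inX (c *: f).
Proof.
by move=> Xf; rewrite -[_ *: _]addr0; apply: subspaceP => //; exact: subspace0.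
Qed.

Lemma subspaceB f g : inX f -> inX g -> inX (f - g).
Proof.
by move=> Xf Xg; rewrite -scaleN1r; apply: subspaceD => //; exact: subspaceZ.
Qed.

Lemma parallelogram f g :
  nrm (f + g) ^+ 2 + nrm (f - g) ^+ 2 = 2 * nrm f ^+ 2 + 2 * nrm g ^+ 2.
Proof. by rewrite nrm_sqrB nrm_sqrD; ring. Qed.

(** Near-minimizers of the distance cluster by the parallelogram law, so completeness gives a limit,
    which stays in the closed set [X]. *)
Lemma nearest_point f :
  exists2 g, inX g & forall h, inX h -> nrm (f - g) <= nrm (f - h).
Proof.
pose D := [set nrm (f - h) ^+ 2 | h in inX].
have D0 : D !=set0 by exists (nrm (f - 0) ^+ 2); exists 0 => //;
  exact: subspace0.
have Dlb : has_lbound D by exists 0 => _ [h _ <-]; rewrite sqr_ge0.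
pose d := inf D.
have dle h : inX h -> d <= nrm (f - h) ^+ 2.
  by move=> Xh; apply: ge_inf => //; exists h.
(* The sets of near-minimizers form a filter base, which replaces the choice of a minimizing
   sequence. *)
pose N (e : R) := [set h | inX h /\ nrm (f - h) ^+ 2 < d + e].
pose F := filter_from [set e | 0 < e] N.
have FF : ProperFilter F.
  apply: filter_from_proper; last first.
    move=> e /= e0; have [|_ [h Xh <-] hd] := @inf_adherent _ D e e0;
      first by split.
    by exists h.
  apply: filter_from_filter; first by exists 1 => /=.
  move=> a b /= a0 b0; exists (Num.min a b); first by rewrite /= lt_min a0.
  move=> h [Xh hd]; split; split=> //; apply: (lt_le_trans hd); rewrite lerD2l.
    by rewrite ge_min lexx.
  by rewrite ge_min lexx orbT.
(* The midpoint of [g] and [h] lies in [X], so its squared distance to [f] is at least [d]; the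
   parallelogram law leaves at most [4 * e] for [|g - h|^2]. *)
have close e g h : N e g -> N e h -> nrm (g - h) ^+ 2 <= 4 * e.
  move=> [Xg gd] [Xh hd].
  have Xm : inX (of_real 2^-1 *: (g + h)) by exact/subspaceZ/subspaceD.
  have := parallelogram (f - g) (f - h).
  have -> : f - g + (f - h) = of_real 2 *: (f - of_real 2^-1 *: (g + h)).
    rewrite scalerBr scalerA -of_realM mulfV// of_real1 scale1r opprD addrACA.
    by rewrite (_ : 2 = 1 + 1)// of_realD of_real1 scalerDl scale1r.
  have -> : f - g - (f - h) = - (g - h).
    by rewrite !opprB addrC addrA subrK.
  rewrite nrmN nrmZr ger0_norm// exprMn; have := dle _ Xm; lra.
have [l Fl] : exists l, forall e, 0 < e -> F [set y | nrm (l - y) < e].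
  (* With this [e'] the bound [4 * e'] equals [e ^+ 2 / 2], strictly below [e ^+ 2]. *)
  apply: cauchy_nrm => e e0; pose e' := e ^+ 2 / 8.
  have e'0 : 0 < e' by rewrite divr_gt0// exprn_gt0.
  have FN : F (N e') by exists e'.
  have [g Ng] := filter_ex FN; exists g; apply: filterS FN => h Nh /=.
  rewrite -(ltr_pXn2r (n := 2))// ?nnegrE ?nrm_ge0 ?ltW//.
  apply: (le_lt_trans (close _ _ _ Ng Nh)); rewrite /e'.
  have : 0 < e ^+ 2 by rewrite exprn_gt0.
  by lra.
have FX : F inX by exists 1 => //= h [].
exists l.
  apply: (@closed_cvg _ _ F FF id inX _ FX l);
    first exact: (@subspace_closed _ _ _ X).
  exact/cvg_nrmP.
move=> h Xh; apply/ler_addgt0Pr => e e0.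
have e2 : 0 < e / 2 by rewrite divr_gt0.
(* The tolerance [(e / 2) ^+ 2] on squares is absorbed by the square of [nrm (f - h) + e / 2]; the
   other [e / 2] pays for replacing [g] by [l]. *)
have FN : F (N ((e / 2) ^+ 2)) by exists ((e / 2) ^+ 2) => //=;
  rewrite exprn_gt0.
have [g [[Xg gd] /= lg]] := filter_ex (filterI FN (Fl _ e2)).
have gh : nrm (f - g) <= nrm (f - h) + e / 2.
  rewrite -(ler_pXn2r (n := 2))// ?nnegrE ?addr_ge0 ?nrm_ge0 ?(ltW e2)//.
  rewrite (le_trans (ltW gd))// sqrrD; have := dle _ Xh.
  have : 0 <= nrm (f - h) * (e / 2) by rewrite mulr_ge0 ?nrm_ge0// ltW.
  by rewrite mulr2n; lra.
have -> : f - l = (f - g) - (l - g) by rewrite opprB addrA subrK.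
by rewrite (le_trans (nrmB _ _))//; lra.
Qed.

(** A nearest point satisfies the defining property, so the [xget] in [orth_proj] never falls back
    on its default. *)
Lemma orth_projP f : inX (orth_proj X f) /\
  forall h, inX h -> inner (f - orth_proj X f) h = 0.
Proof.
rewrite /orth_proj; case: xgetP => [g _ []//|/= noP]; exfalso.
have [g Xg gmin] := nearest_point f; apply: (noP g); split=> //.
apply: inner_eq0_rin => h Xh; set z := f - g.
have [/eqP|h0] := eqVneq (nrm h) 0.
  by move/eqP/nrm0_eq0 => ->; rewrite rinC rin0l.
(* Minimality of [|z|] against [z - t h] at the optimal [t = <z,h> / |h|^2]. *)
pose t := rin z h / nrm h ^+ 2.
have := gmin _ (subspaceD Xg (subspaceZ (of_real t) Xh)).
rewrite opprD addrA -/z -(ler_pXn2r (n := 2))// ?nnegrE ?nrm_ge0//.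
rewrite [X in _ <= X]nrm_sqrB.
rewrite rinZr nrmZr exprMn real_normK ?num_real//.
have -> : nrm z ^+ 2 - 2 * (t * rin z h) + t ^+ 2 * nrm h ^+ 2 =
    nrm z ^+ 2 - (rin z h) ^+ 2 / nrm h ^+ 2 by rewrite /t; field.
rewrite lerDl oppr_ge0 => hle.
have h2 : 0 < nrm h ^+ 2 by rewrite exprn_gt0// lt_def h0 nrm_ge0.
apply/eqP; rewrite -sqrf_eq0 eq_le sqr_ge0 andbT.
by move: hle; rewrite pmulr_lle0 ?invr_gt0.
Qed.

Lemma orth_proj_sub f : inX (orth_proj X f).
Proof. by case: (orth_projP f). Qed.

Lemma orth_proj_orth f h : inX h -> inner (f - orth_proj X f) h = 0.
Proof. by case: (orth_projP f) => _; apply. Qed.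

Lemma rin_projr f h : inX h -> rin h (orth_proj X f) = rin h f.
Proof.
move=> Xh; rewrite !(rinC h); apply/eqP; rewrite eq_sym -subr_eq0 -rinNl -rinDl.
by rewrite /rin orth_proj_orth//; case: (k).
Qed.

(** The difference of two candidates lies in [X] and is a difference of two residuals orthogonal to
    [X], hence is orthogonal to itself. *)
Lemma orth_proj_unique f g : inX g ->
  (forall h, inX h -> inner (f - g) h = 0) -> orth_proj X f = g.
Proof.
move=> Xg og; apply/eqP; rewrite -subr_eq0; apply/eqP.
set d := _ - _; have Xd : inX d by apply: subspaceB => //; exact: orth_proj_sub.
have dE : d = (f - g) - (f - orth_proj X f).
  by rewrite opprB [RHS]addrC addrA subrK.
have : rin d d = 0.
  by rewrite {1}dE rinDl rinNl /rin og ?orth_proj_orth// subrr.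
by rewrite rinxx => /eqP; rewrite sqrf_eq0 => /eqP /nrm0_eq0.
Qed.

Lemma orth_proj_linear : linear (orth_proj X).
Proof.
move=> a f g; apply: orth_proj_unique.
  by apply: subspaceD; [apply: subspaceZ|]; exact: orth_proj_sub.
move=> h Xh; rewrite opprD addrACA -scalerBr innerDl innerZl.
by rewrite !orth_proj_orth// mulr0 addr0.
Qed.

Lemma rin_proj f : rin (orth_proj X f) f = nrm (orth_proj X f) ^+ 2.
Proof. by rewrite -rinxx rin_projr//; exact: orth_proj_sub. Qed.

Lemma nrm_proj_le f : nrm (orth_proj X f) <= nrm f.
Proof.
apply: (nrm_le_of_sqr (nrm_ge0 f)); rewrite -rin_proj.
by rewrite (le_trans (rin_le _ _))// mulrC.
Qed.

End projection.

(** * Cauchy-Schwarz and Minkowski for finite sums *)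

Section finite_l2.
Context {R : realType} {I : choiceType}.
Implicit Types (A : seq I) (a b : I -> R).

(** The Euclidean norm over a finite index list. Estimates are carried out at this level, where
    summability is no concern, and then passed to the supremum. *)
Definition fl2 A a : R := Num.sqrt (\sum_(i <- A) a i ^+ 2).

Lemma fl2_ge0 A a : 0 <= fl2 A a.
Proof. exact: sqrtr_ge0. Qed.

Lemma fl2_sqr A a : fl2 A a ^+ 2 = \sum_(i <- A) a i ^+ 2.
Proof. by rewrite sqr_sqrtr// sumr_ge0// => i _; rewrite sqr_ge0. Qed.

Lemma fl2_le A a b : (forall i, 0 <= a i <= b i) -> fl2 A a <= fl2 A b.
Proof.
move=> ab; rewrite ler_wsqrtr// ler_sum// => i _; have /andP[a0 aib] := ab i.
by rewrite lerXn2r ?nnegrE// (le_trans a0).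
Qed.

Lemma fl2Z A c a : 0 <= c -> fl2 A (fun i => c * a i) = c * fl2 A a.
Proof.
move=> c0; rewrite /fl2; under eq_bigr do rewrite exprMn.
by rewrite -mulr_sumr sqrtrM ?sqr_ge0// sqrtr_sqr ger0_norm.
Qed.

(** The sum of the squares [(t * a i - b i) ^+ 2] is a nonnegative quadratic in [t], evaluated below
    at suitable points. *)
Lemma cauchy_schwarz_sum A a b : \sum_(i <- A) a i * b i <= fl2 A a * fl2 A b.
Proof.
set S := \sum_(i <- A) _.
have quad t : 0 <= t ^+ 2 * fl2 A a ^+ 2 - 2 * t * S + fl2 A b ^+ 2.
  rewrite !fl2_sqr /S !mulr_sumr -sumrB -big_split/=; apply: sumr_ge0 => i _.
  by rewrite [leRHS](_ : _ = (t * a i - b i) ^+ 2) ?sqr_ge0//; ring.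
have a0 := fl2_ge0 A a; have b0 := fl2_ge0 A b.
(* If [fl2 A a] vanishes the quadratic is affine in [t]; at [(fl2 A b ^+ 2 + 1) / S] it would be
   negative, so [S] is 0. *)
have [aE|aN] := eqVneq (fl2 A a) 0.
  have := quad (fl2 A b ^+ 2 + 1); have := quad (((fl2 A b) ^+ 2 + 1) / S).
  have [->|S0] := eqVneq S 0; first by rewrite mulr_ge0.
  rewrite aE expr0n mulr0 add0r -mulrA divfK//.
  by have := sqr_ge0 (fl2 A b); lra.
have ap : 0 < fl2 A a by rewrite lt_def aN.
have : S ^+ 2 <= (fl2 A a * fl2 A b) ^+ 2.
  (* This [t] minimizes the quadratic. *)
  have := quad (S / fl2 A a ^+ 2).
  rewrite [X in 0 <= X](_ : _ = fl2 A b ^+ 2 - S ^+ 2 / fl2 A a ^+ 2);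
    last by field.
  by rewrite subr_ge0 ler_pdivrMr ?exprn_gt0// exprMn mulrC.
rewrite -(ler_sqrt (S ^+ 2)) ?sqr_ge0// !sqrtr_sqr (ger0_norm (mulr_ge0 a0 b0)).
by apply: le_trans; rewrite ler_norm.
Qed.

Lemma fl2D A a b : fl2 A (fun i => a i + b i) <= fl2 A a + fl2 A b.
Proof.
rewrite -(ler_pXn2r (n := 2))// ?nnegrE ?addr_ge0 ?fl2_ge0// sqrrD !fl2_sqr.
under eq_bigr do rewrite sqrrD -mulr_natr.
rewrite !big_split/= -mulr_suml -[X in _ <= _ + X + _]mulr_natr lerD2r lerD2l.
rewrite ler_wpM2r//; exact: cauchy_schwarz_sum.
Qed.

End finite_l2.

(** * Sums of nonnegative families as suprema of finite sums *)

Section nonneg_sums.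
Context {R : realType} {I : countType}.
Implicit Types (A : {fset I}) (a : I -> R).

Definition finite_sum a := (\esum_(i in [set: I]) (a i)%:E < +oo)%E.

Lemma sum_le_esum A a : (forall i, 0 <= a i) ->
  ((\sum_(i <- A) a i)%:E <= \esum_(i in [set: I]) (a i)%:E)%E.
Proof.
move=> a0; apply: ereal_sup_ubound; exists [set` A]; first by split.
by rewrite fsbig_finite//= set_fsetK sumEFin.
Qed.

Lemma esum_le a (c : \bar R) :
  (forall A, ((\sum_(i <- A) a i)%:E <= c)%E) ->
  (\esum_(i in [set: I]) (a i)%:E <= c)%E.
Proof.
move=> ac; apply: ge_ereal_sup => _ [F [finF _] <-].
by rewrite fsbig_finite//= sumEFin.
Qed.

Lemma rsumK a : (forall i, 0 <= a i) -> finite_sum a ->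
  (\esum_(i in [set: I]) (a i)%:E)%E = (rsum a)%:E.
Proof.
move=> a0 fa; rewrite /rsum fineK// ge0_fin_numE//.
by apply: esum_ge0 => i _; rewrite lee_fin.
Qed.

Lemma sum_le_rsum A a : (forall i, 0 <= a i) -> finite_sum a ->
  \sum_(i <- A) a i <= rsum a.
Proof. by move=> a0 fa; rewrite -lee_fin -rsumK// sum_le_esum. Qed.

Lemma finite_sum_le a c : (forall A, \sum_(i <- A) a i <= c) -> finite_sum a.
Proof.
by move=> ac; apply: le_lt_trans (ltry c); apply: esum_le => A; rewrite lee_fin.
Qed.

Lemma rsum_le a c : (forall i, 0 <= a i) ->
  (forall A, \sum_(i <- A) a i <= c) -> rsum a <= c.
Proof.
move=> a0 ac; rewrite -lee_fin -rsumK//; last exact: finite_sum_le ac.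
by apply: esum_le => A; rewrite lee_fin.
Qed.

Lemma rsum_approx a e : (forall i, 0 <= a i) -> finite_sum a -> 0 < e ->
  exists A, rsum a - e < \sum_(i <- A) a i.
Proof.
move=> a0 fa e0; apply/not_existsP => noA.
have : rsum a <= rsum a - e.
  by apply: rsum_le => // A; rewrite leNgt; apply/negP; exact: noA.
by lra.
Qed.

Lemma fl2_le_rsum A a : finite_sum (fun i => a i ^+ 2) ->
  fl2 A a <= Num.sqrt (rsum (fun i => a i ^+ 2)).
Proof.
by move=> fa; rewrite ler_wsqrtr// sum_le_rsum// => i; rewrite sqr_ge0.
Qed.

Lemma finite_sum_fl2 a c :
  (forall A, fl2 A a <= c) -> finite_sum (fun i => a i ^+ 2).
Proof.
move=> ac; apply: (@finite_sum_le _ (c ^+ 2)) => A; rewrite -fl2_sqr.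
by rewrite lerXn2r ?nnegrE ?fl2_ge0// (le_trans _ (ac A)) ?fl2_ge0.
Qed.

Lemma rsum_fl2 a c : (forall A, fl2 A a <= c) ->
  Num.sqrt (rsum (fun i => a i ^+ 2)) <= c.
Proof.
move=> ac; have c0 : 0 <= c by rewrite (le_trans _ (ac fset0)) ?fl2_ge0.
rewrite -(ger0_norm c0) -sqrtr_sqr ler_wsqrtr// rsum_le// => [i|A].
  by rewrite sqr_ge0.
by rewrite -fl2_sqr lerXn2r ?nnegrE ?fl2_ge0.
Qed.

End nonneg_sums.

(** * Unconditional sums of vectors *)

Section unconditional_sums.
Context {R : realType} {k : scalars} {I : countType}.

(** Convergence of the net of finite partial sums, spelled out because [summability.sum] is a total
    function whose value alone carries no convergence. *)
Definition has_sum (E : normedModType (scalar_field R k)) (u : I -> E)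
    (l : E) :=
  forall e : R, 0 < e -> exists A0 : {fset I}, forall A : {fset I},
    (A0 `<=` A)%fset -> nrm (l - \sum_(i <- A) u i) < e.

Lemma has_sum_sum (E : normedModType (scalar_field R k)) (u : I -> E) (l : E) :
  has_sum u l -> summability.sum u = l.
Proof.
move=> ul; have FF := @summability.totally_filter I.
apply/cvg_lim; first exact: norm_hausdorff.
apply/cvg_nrmP => e e0; have [A0 A0u] := ul e e0.
exists A0 => // A /= /A0u; rewrite /summability.partial_sum.
by rewrite (big_seq_fsetE _ A predT u).
Qed.

Lemma has_sum_lin (E : normedModType (scalar_field R k)) (u w : I -> E)
    (l m : E) c :
  has_sum u l -> has_sum w m -> has_sum (fun i => c *: u i + w i) (c *: l + m).
Proof.
move=> ul wm e e0.
have c0 : 0 <= re_part `|c| := @nrm_ge0 R k (scalar_field R k)^o c.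
have c1 : 0 < re_part `|c| + 1 by rewrite ltr_wpDl.
have [A0 uA] := ul _ (divr_gt0 (divr_gt0 e0 (ltr0Sn R 1)) c1).
have [A1 wA] := wm _ (divr_gt0 e0 (ltr0Sn R 1)).
exists (A0 `|` A1)%fset => A; rewrite fsubUset => /andP[/uA uAe /wA wAe].
rewrite big_split/= -scaler_sumr opprD addrACA -scalerBr.
rewrite (le_lt_trans (nrmD _ _))// nrmZ.
move: uAe; rewrite ltr_pdivlMr// mulrDr mulr1 mulrC.
by have := nrm_ge0 (l - \sum_(i <- A) u i); lra.
Qed.

Lemma has_sum_nrm_le (E : normedModType (scalar_field R k)) (u : I -> E)
    (l : E) c :
  has_sum u l -> (forall A : {fset I}, nrm (\sum_(i <- A) u i) <= c) ->
  nrm l <= c.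
Proof.
move=> ul uc; apply/ler_addgt0Pr => e e0;
  have [A /(_ A (fsubset_refl _))] := ul e e0.
rewrite -[in nrm l](subrK (\sum_(i <- A) u i) l) => lt_e.
by rewrite (le_trans (nrmD _ _))// addrC lerD// ltW.
Qed.

Lemma has_sum_rin_ge (H : hilbertType R k) (u : I -> H) (l g : H) c
    (A1 : {fset I}) :
  has_sum u l ->
  (forall A : {fset I}, (A1 `<=` A)%fset -> c <= rin (\sum_(i <- A) u i) g) ->
  c <= rin l g.
Proof.
move=> ul uc; apply/ler_addgt0Pr => e e0.
have g1 : 0 < nrm g + 1 by rewrite ltr_wpDl ?nrm_ge0.
have [A0 /(_ (A0 `|` A1)%fset (fsubsetUl _ _))] := ul _ (divr_gt0 e0 g1).
have := uc (A0 `|` A1)%fset (fsubsetUr _ _); move: (\sum_(i <- _) _) => s cs.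
rewrite ltr_pdivlMr// => h.
have := rin_le (s - l) g; rewrite nrmBC rinDl rinNl.
move: h; rewrite mulrDr mulr1; have := nrm_ge0 (l - s); lra.
Qed.

Lemma sum_fsetU_diff (E : zmodType) (u : I -> E) (A B : {fset I}) :
  (A `<=` B)%fset ->
  \sum_(i <- B) u i = \sum_(i <- A) u i + \sum_(i <- (B `\` A)%fset) u i.
Proof.
move=> AB; rewrite (big_fsetID _ (mem A)) /=; congr (_ + _).
  by apply: eq_fbigl => i; rewrite !inE/= andbC;
    case: (boolP (i \in A)) => // /(fsubsetP AB) ->.
by apply: eq_fbigl => i; rewrite !inE/= andbC.
Qed.

(** Once [A0] captures almost all of the sum of squares, any finite set disjoint from [A0] has small
    [fl2], so the net of partial sums is Cauchy. *)
Lemma has_sum_ex (E : completeNormedModType (scalar_field R k)) (u : I -> E)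
    (a : I -> R) (C : R) :
  (forall A : {fset I}, nrm (\sum_(i <- A) u i) <= C * fl2 A a) ->
  finite_sum (fun i => a i ^+ 2) -> exists l, has_sum u l.
Proof.
move=> uCa fa.
pose F := ((fun A : {fset I} => \sum_(i <- A) u i) @ @summability.totally I).
have FF : ProperFilter F.
  by apply: fmap_proper_filter; exact: summability.totally_filter.
have a0 i : 0 <= a i ^+ 2 by exact: sqr_ge0.
have [l Fl] : exists l, forall e, 0 < e -> F [set y | nrm (l - y) < e].
  apply: cauchy_nrm => e e0.
  have C1 : 0 < `|C| + 1 by rewrite ltr_wpDl.
  pose d := e / (`|C| + 1); have d0 : 0 < d by rewrite divr_gt0.
  (* The precision is [d ^+ 2] because the tail of the squares bounds the square of [fl2]. *)
  have [A0 A0a] := rsum_approx a0 fa (exprn_gt0 2 d0).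
  exists (\sum_(i <- A0) u i); exists A0 => // A /= A0A.
  rewrite (sum_fsetU_diff u A0A) opprD addrA subrr sub0r nrmN.
  have := sum_le_rsum A a0 fa; rewrite (sum_fsetU_diff _ A0A) => hA.
  have : fl2 (A `\` A0)%fset a < d.
    rewrite -(ltr_pXn2r (n := 2))// ?nnegrE ?fl2_ge0 ?(ltW d0)//.
    by move: hA; rewrite fl2_sqr; lra.
  rewrite ltr_pdivlMr// => hd; apply: le_lt_trans hd.
  rewrite (le_trans (uCa _))// mulrC ler_wpM2l ?fl2_ge0//.
  by rewrite (le_trans (ler_norm _))// lerDl.
by exists l => e /Fl [A0 _ A0F]; exists A0.
Qed.

End unconditional_sums.

(** * The direct sum through its finite norms *)

Section ell2_lemmas.
Context {R : realType} {k : scalars} {H : hilbertType R k} {I : countType}.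
Implicit Types (X : I -> closed_subspace H).

Lemma in_ell2_fl2 X (f : I -> H) (c : R) :
  (forall i, subspace_set (X i) (f i)) ->
  (forall A : {fset I}, fl2 A (fun i => nrm (f i)) <= c) -> f \in in_ell2 X.
Proof.
by move=> Xf fc; apply/in_ell2P; split=> //; exact: finite_sum_fl2 fc.
Qed.

Lemma ell2_finite_sum X (f : ell2 X) : finite_sum (fun i => nrm (f i) ^+ 2).
Proof. by have /in_ell2P[] := valP f. Qed.

Lemma fl2_le_nrm X (f : ell2 X) (A : {fset I}) :
  fl2 A (fun i => nrm (f i)) <= nrm f.
Proof. by rewrite nrm_ell2; exact/fl2_le_rsum/ell2_finite_sum. Qed.

Lemma nrm_ell2_le X (f : ell2 X) (c : R) :
  (forall A : {fset I}, fl2 A (fun i => nrm (f i)) <= c) -> nrm f <= c.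
Proof.
by move=> fc; rewrite nrm_ell2; exact: (rsum_fl2 (a := fun i => nrm (f i))).
Qed.

Lemma ell2_ext X (f g : ell2 X) : (forall i, f i = g i) -> f = g.
Proof. by move=> fg; apply: val_inj; apply/funext. Qed.

Lemma ell2_lin X c (f g : ell2 X) i : (c *: f + g : ell2 X) i = c *: f i + g i.
Proof. by []. Qed.

End ell2_lemmas.

(** * Operators attached to Bessel fusion sequences and fusion frames *)

Section fusion_operators.
Context {R : realType} {k : scalars} {H : hilbertType R k} {I : countType}.
Implicit Types (X Y : I -> closed_subspace H) (x y : I -> R).

Lemma bessel_fusion_mono X x (B B' : R) : B <= B' ->
  bessel_fusion X x B -> bessel_fusion X x B'.
Proof.
move=> BB' [x0 xB]; split=> // f; apply: (le_trans (xB f)).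
by rewrite lee_fin ler_wpM2r// sqr_ge0.
Qed.

Lemma bessel_fl2 X x B (A : {fset I}) (f : H) : bessel_fusion X x B ->
  fl2 A (fun i => x i * nrm (orth_proj (X i) f)) <= Num.sqrt B * nrm f.
Proof.
move=> [_ xB]; rewrite -[in leRHS](ger0_norm (nrm_ge0 f)) -sqrtr_sqr.
rewrite mulrC -sqrtrM ?sqr_ge0// ler_wsqrtr// mulrC -lee_fin.
apply: le_trans (xB f); under eq_bigr do rewrite exprMn.
by apply: sum_le_esum => i; rewrite mulr_ge0// sqr_ge0.
Qed.

Lemma bessel_finite_sum X x B (f : H) : bessel_fusion X x B ->
  finite_sum (fun i => (x i * nrm (orth_proj (X i) f)) ^+ 2).
Proof. by move=> xB; exact: (finite_sum_fl2 (fun A => bessel_fl2 A f xB)). Qed.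

Lemma sqr_weight (x a : I -> R) :
  (fun i => x i ^+ 2 * a i ^+ 2) = (fun i => (x i * a i) ^+ 2).
Proof. by apply/funext => i; rewrite exprMn. Qed.

Lemma bessel_rsum X x B (f : H) : bessel_fusion X x B ->
  Num.sqrt (rsum (fun i => x i ^+ 2 * nrm (orth_proj (X i) f) ^+ 2))
  <= Num.sqrt B * nrm f.
Proof.
move=> xB; rewrite sqr_weight.
by apply: rsum_fl2 => A; exact: bessel_fl2.
Qed.

Section bessel.
Variables (X : I -> closed_subspace H) (x : I -> R) (B : R).
Hypothesis xB : bessel_fusion X x B.

Let x0 i : 0 < x i. Proof. by case: xB. Qed.

(** A duality argument: pairing the sum [s] with itself moves the projections onto [s], where the
    Bessel inequality applies, and one factor [nrm s] cancels. *)
Lemma synthesis_fin_bound (A : {fset I}) (f : I -> H) :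
  (forall i, subspace_set (X i) (f i)) ->
  nrm (\sum_(i <- A) of_real (x i) *: f i) <=
    Num.sqrt B * fl2 A (fun i => nrm (f i)).
Proof.
move=> Xf; set s := \sum_(i <- A) _.
apply: nrm_le_of_sqr; first by rewrite mulr_ge0 ?sqrtr_ge0 ?fl2_ge0.
rewrite -rinxx {1}/s rin_suml.
apply: (@le_trans _ _
  (\sum_(i <- A) nrm (f i) * (x i * nrm (orth_proj (X i) s)))).
  apply: ler_sum => i _; rewrite rinZl mulrCA ler_wpM2l ?(ltW (x0 i))//.
  by rewrite -(rin_projr _ (Xf i)) rin_le.
rewrite (le_trans (cauchy_schwarz_sum _ _ _))//
  mulrC mulrAC ler_wpM2r ?fl2_ge0//.
exact: bessel_fl2.
Qed.

Lemma synthesis_has_sum (f : ell2 X) :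
  has_sum (fun i => of_real (x i) *: f i : H) (synthesis_op X x f).
Proof.
have [l fl] : exists l, has_sum (fun i => of_real (x i) *: f i : H) l.
  apply: has_sum_ex (ell2_finite_sum f) => A.
  by apply: synthesis_fin_bound => i; exact: ell2_sub.
by rewrite /synthesis_op (has_sum_sum fl).
Qed.

Lemma synthesis_linear : linear (synthesis_op X x).
Proof.
move=> c f g; apply: has_sum_sum.
have := has_sum_lin c (synthesis_has_sum f) (synthesis_has_sum g).
congr has_sum; apply/funext => i; rewrite ell2_lin scalerDr.
by rewrite !scalerA mulrC.
Qed.

Lemma synthesis_bound : nrm_bound (synthesis_op X x) (Num.sqrt B).
Proof.
move=> f; apply: has_sum_nrm_le (synthesis_has_sum f) _ => A.
rewrite (le_trans (synthesis_fin_bound _ _))// => [i|]; first exact: ell2_sub.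
by rewrite ler_wpM2l ?sqrtr_ge0// fl2_le_nrm.
Qed.

Lemma fl2_analysis (A : {fset I}) (f : H) :
  fl2 A (fun i => nrm (of_real (x i) *: orth_proj (X i) f)) =
  fl2 A (fun i => x i * nrm (orth_proj (X i) f)).
Proof.
by congr fl2; apply/funext => i /=; rewrite nrmZr ger0_norm// ltW.
Qed.

(** The Bessel bound puts the family in the direct sum, so [insubd] does not return its default. *)
Lemma analysisE (f : H) i :
  analysis_op X x f i = of_real (x i) *: orth_proj (X i) f.
Proof.
have h : (fun i => of_real (x i) *: orth_proj (X i) f) \in in_ell2 X.
  apply: (@in_ell2_fl2 _ _ _ _ _ _ (Num.sqrt B * nrm f)) => [j|A].
    by apply: subspaceZ; exact: orth_proj_sub.
  by rewrite fl2_analysis; exact: bessel_fl2.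
by have := congr1 (fun g => g i) (insubdK (0 : ell2 X) h).
Qed.

Lemma analysis_linear : linear (analysis_op X x).
Proof.
move=> c f g; apply: ell2_ext => i;
  rewrite ell2_lin !analysisE orth_proj_linear.
by rewrite scalerDr !scalerA mulrC.
Qed.

Lemma analysis_bound : nrm_bound (analysis_op X x) (Num.sqrt B).
Proof.
move=> f; apply: nrm_ell2_le => A.
have -> : (fun i => nrm (analysis_op X x f i)) =
    (fun i => nrm (of_real (x i) *: orth_proj (X i) f)).
  by apply/funext => i; rewrite analysisE.
by rewrite fl2_analysis; exact: bessel_fl2.
Qed.

Lemma frame_has_sum (f : H) :
  has_sum (fun i => of_real (x i ^+ 2) *: orth_proj (X i) f)
    (frame_operator X x f).
Proof.
have := synthesis_has_sum (analysis_op X x f).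
congr has_sum; apply/funext => i.
by rewrite analysisE scalerA -of_realM expr2.
Qed.

Lemma frame_linear : linear (frame_operator X x).
Proof.
by move=> c f g; rewrite /frame_operator analysis_linear synthesis_linear.
Qed.

Lemma frame_bound : nrm_bound (frame_operator X x) (Num.sqrt B * Num.sqrt B).
Proof.
move=> f; rewrite (le_trans (synthesis_bound _))//
  -mulrA ler_wpM2l ?sqrtr_ge0//.
exact: analysis_bound.
Qed.

(** Pairing the partial sums of [S f] with [f] gives nonnegative terms, so a finite set nearly
    exhausting the total keeps its lower bound when enlarged. *)
Lemma frame_rin_ge (A : R) (f : H) :
  ((A * nrm f ^+ 2)%:E <=
     \esum_(i in [set: I]) (x i ^+ 2 * nrm (orth_proj (X i) f) ^+ 2)%:E)%E ->
  A * nrm f ^+ 2 <= rin (frame_operator X x f) f.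
Proof.
set a := fun i => x i ^+ 2 * nrm (orth_proj (X i) f) ^+ 2.
have a0 i : 0 <= a i by rewrite mulr_ge0 ?sqr_ge0.
have fa : finite_sum a.
  by rewrite /a sqr_weight; exact: bessel_finite_sum xB.
rewrite (rsumK a0 fa) lee_fin => /le_trans; apply.
apply/ler_addgt0Pr => e e0; have [A0 A0a] := rsum_approx a0 fa e0.
rewrite -lerBlDr; apply: (has_sum_rin_ge (A1 := A0) (frame_has_sum f)) => F A0F.
apply: (le_trans (ltW A0a)); rewrite rin_suml (sum_fsetU_diff _ A0F).
under eq_bigr do rewrite /a -rin_proj -rinZl.
rewrite lerDl sumr_ge0// => i _.
by rewrite rinZl rin_proj mulr_ge0 ?sqr_ge0.
Qed.

End bessel.

(** A Lax-Milgram argument: coercivity makes [1 - t S] a contraction for a suitable [t], and [t]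
    times the Neumann inverse of [t S] inverts [S]. *)
Lemma coercive_inverse (S : H -> H) (a M : R) : linear S -> 0 < a -> a <= M ->
    nrm_bound S M -> (forall f, a * nrm f ^+ 2 <= rin (S f) f) ->
  exists Si : H -> H, [/\ linear Si, exists C, nrm_bound Si C,
    cancel S Si & cancel Si S].
Proof.
move=> lS a0 aM bS cS; have M0 : 0 < M := lt_le_trans a0 aM.
(* [t] minimizes the bound [1 - 2 t a + t^2 M^2] on [|f - t S f|^2 / |f|^2]. *)
pose t := a / M ^+ 2; have t0 : 0 < t by rewrite divr_gt0// exprn_gt0.
pose K f := f - of_real t *: S f.
(* [r] is the value of that bound at its minimizer; [a <= M] makes it nonnegative, so that [q]
   squares back to [r]. *)
pose r := 1 - (a / M) ^+ 2; pose q := Num.sqrt r.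
have aM1 : 0 < a / M <= 1 by rewrite divr_gt0// ler_pdivrMr// mul1r.
have r0 : 0 <= r by rewrite subr_ge0 exprn_ile1//; case/andP: aM1 => /ltW.
have r1 : r < 1.
  by case/andP: aM1 => h _; rewrite gtrDl oppr_lt0 exprn_gt0.
have q01 : 0 <= q < 1.
  by rewrite sqrtr_ge0 -sqrtr1 ltr_sqrt.
have lK : linear K.
  move=> c f g; rewrite /K lS scalerDr opprD addrACA scalerBr.
  by rewrite !scalerA (mulrC c).
have bK : nrm_bound K q.
  move=> f; rewrite -(ler_pXn2r (n := 2))//
    ?nnegrE ?mulr_ge0 ?nrm_ge0 ?sqrtr_ge0//.
  rewrite exprMn sqr_sqrtr// nrm_sqrB rinZr nrmZr ger0_norm ?(ltW t0)//.
  have h1 : nrm (S f) ^+ 2 <= M ^+ 2 * nrm f ^+ 2.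
    by rewrite -exprMn lerXn2r ?nnegrE ?mulr_ge0 ?nrm_ge0 ?(ltW M0).
  have h2 := cS f; rewrite (rinC f).
  have : t ^+ 2 * nrm (S f) ^+ 2 <= t ^+ 2 * (M ^+ 2 * nrm f ^+ 2).
    by rewrite ler_wpM2l ?sqr_ge0.
  have : t * (a * nrm f ^+ 2) <= t * rin (S f) f by rewrite ler_wpM2l ?(ltW t0).
  have -> : r * nrm f ^+ 2 = nrm f ^+ 2 - 2 * (t * (a * nrm f ^+ 2))
      + t ^+ 2 * (M ^+ 2 * nrm f ^+ 2).
    by rewrite /r /t; field; rewrite gt_eqF.
  rewrite (exprMn _ t); lra.
have [L [lL bL LK KL]] := neumann_inverse lK q01 bK.
have idK f : f - K f = of_real t *: S f by rewrite /K opprB addrC subrK.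
exists (fun f => of_real t *: L f); split.
- by move=> c f g; rewrite lL scalerDr !scalerA mulrC.
- exists (t * (1 - q)^-1) => f.
  by rewrite nrmZr ger0_norm ?(ltW t0)// -mulrA ler_wpM2l ?(ltW t0).
- by move=> f; rewrite -(linZ lL) -idK LK.
- by move=> f; rewrite (linZ lS) -idK KL.
Qed.

(** The Bessel bound gives the norm bound [B] and the lower frame bound gives coercivity with
    constant [a]. *)
Lemma frame_opinv X x (a B : R) : fusion_frame X x a B ->
  [/\ linear (opinv (frame_operator X x)),
      exists C, nrm_bound (opinv (frame_operator X x)) C,
      cancel (frame_operator X x) (opinv (frame_operator X x)) &
      cancel (opinv (frame_operator X x)) (frame_operator X x)].
Proof.
move=> [a0 aB xB low]; have B0 := lt_le_trans a0 aB.
have bS := frame_bound xB; rewrite -expr2 sqr_sqrtr ?(ltW B0)// in bS.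
have [f|Si [lSi bSi SK KS]] := coercive_inverse (frame_linear xB) a0 aB bS.
  exact: (frame_rin_ge xB (low f)).
by rewrite (opinvE SK KS).
Qed.

(** * The operator [phi_op] under a bounded inverse frame operator *)

Section phi.
Variables (X Y : I -> closed_subspace H) (y : I -> R) (M : R).
Hypothesis lin_inv : linear (opinv (frame_operator Y y)).
Hypothesis bound_inv : nrm_bound (opinv (frame_operator Y y)) M.
Hypothesis M0 : 0 <= M.

Lemma fl2_phi (f : ell2 Y) (A : {fset I}) :
  fl2 A (fun i => nrm (orth_proj (X i) (opinv (frame_operator Y y) (f i))))
  <= M * nrm f.
Proof.
apply: (@le_trans _ _ (fl2 A (fun i => M * nrm (f i)))); last first.
  by rewrite fl2Z// ler_wpM2l// fl2_le_nrm.
apply: fl2_le => i /=; rewrite nrm_ge0/=.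
by rewrite (le_trans (nrm_proj_le _ _)).
Qed.

Lemma phiE (f : ell2 Y) i :
  phi_op X Y y f i = orth_proj (X i) (opinv (frame_operator Y y) (f i)).
Proof.
have h : (fun i => orth_proj (X i) (opinv (frame_operator Y y) (f i)))
  \in in_ell2 X.
  by apply: in_ell2_fl2 (fl2_phi f) => j; exact: orth_proj_sub.
by have := congr1 (fun g => g i) (insubdK (0 : ell2 X) h).
Qed.

Lemma phi_linear : linear (phi_op X Y y).
Proof.
move=> c f g; apply: ell2_ext => i.
by rewrite ell2_lin !phiE ell2_lin lin_inv orth_proj_linear.
Qed.

End phi.

End fusion_operators.

(** * Perturbing an invertible operator by one that factors through [H] *)

Section factored_perturbation.
Context {R : realType} {k : scalars}.
Context {E : normedModType (scalar_field R k)}.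
Context {H : completeNormedModType (scalar_field R k)}.

Lemma nrm_bound_comp (E1 E2 E3 : normedModType (scalar_field R k))
    (f : E2 -> E3) (g : E1 -> E2) (a b : R) :
  0 <= a -> nrm_bound f a -> nrm_bound g b -> nrm_bound (f \o g) (a * b).
Proof.
by move=> a0 fa gb x; rewrite (le_trans (fa _))// -mulrA ler_wpM2l.
Qed.

(* With [P = S \o A], the inverse of [1 - P T] is [1 + P (1 - T P)^-1 T], so
   that the Neumann series is only needed on [H]. *)
Lemma invertible_factored_perturbation (G S : E -> E) (T : E -> H) (A : H -> E)
    (c t a : R) :
  linear G -> continuous G -> linear S -> cancel G S -> cancel S G ->
  linear T -> linear A -> nrm_bound S c -> nrm_bound T t -> nrm_bound A a ->
  0 <= c -> 0 <= t -> 0 <= a -> c * a * t < 1 ->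
  invertible_operator (fun x => G x - A (T x)).
Proof.
move=> lG cG lS GS SG lT lA bS bT bA c0 t0 a0 cat1.
have [g g0 bG] := continuous_bound lG cG.
pose P := S \o A; pose K := T \o P.
have lP : linear P by move=> z x y; rewrite /P /= lA lS.
have lK : linear K by move=> z x y; rewrite /K /= lP lT.
have bP : nrm_bound P (c * a) by exact: nrm_bound_comp.
have bK : nrm_bound K (t * (c * a)) by exact: nrm_bound_comp.
have q01 : 0 <= t * (c * a) < 1 by rewrite !mulr_ge0//= mulrC.
have [L [lL bL LK KL]] := neumann_inverse lK q01 bK.
set l := (1 - _)^-1 in bL.
have l0 : 0 <= l by rewrite invr_ge0 subr_ge0 ltW//; case/andP: q01.
have lG2 : linear (fun x => G x - A (T x)).
  by move=> z x y; rewrite lG lT lA scalerBr opprD addrACA.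
pose N y := S y + P (L (T (S y))).
have lN : linear N.
  by move=> z x y; rewrite /N lS lT lL lP scalerDr addrACA.
split; first split=> //.
  apply: (bound_continuous (M := g + a * t)) => // x.
  rewrite (le_trans (nrmB _ _))// mulrDl lerD//.
  exact: (nrm_bound_comp a0 bA bT).
exists N; split.
- split=> //.
  apply: (bound_continuous (M := c + c * a * (l * (t * c)))) => // x.
  rewrite (le_trans (nrmD _ _))// mulrDl lerD//.
  have bTS := nrm_bound_comp t0 bT bS.
  exact: (nrm_bound_comp (mulr_ge0 c0 a0) bP (nrm_bound_comp l0 bL bTS)).
(* Here [S] sends [G x - A (T x)] to [x - P (T x)], and [T] sends that to [T x - K (T x)], from
   which [L] recovers [T x]. *)
- move=> x; rewrite /N (linB lS) GS -/(P (T x)) (linB lT) -/(K (T x)) LK.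
  by rewrite subrK.
- move=> y; rewrite /N.
  have -> : G (S y + P (L (T (S y)))) - A (T (S y + P (L (T (S y))))) =
      G (S y + P (L (T (S y))) - P (T (S y + P (L (T (S y)))))).
    by rewrite (linB lG) /P /= SG.
  rewrite (linD lT) -/(K (L (T (S y)))) -addrA -(linB lP) opprD addrCA.
  by rewrite KL addNr (lin0 lP) addr0 SG.
Qed.

End factored_perturbation.

(** * Comparison of two Bessel sequences with common weights *)

Section fusion_perturbation.
Context {R : realType} {k : scalars} {H : hilbertType R k} {I : countType}.
Variables (V Z : I -> closed_subspace H) (v : I -> R) (B : R).
Hypotheses (VB : bessel_fusion V v B) (ZB : bessel_fusion Z v B).
Implicit Types f g h : H.

Let v0 i : 0 < v i. Proof. by case: VB. Qed.

Lemma perturbation_fl2 (lambda1 lambda2 epsilon : R) f :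
  0 <= lambda1 -> 0 <= lambda2 -> 0 < B ->
  Num.sqrt (rsum (fun i =>
     v i ^+ 2 * nrm (orth_proj (Z i) f - orth_proj (V i) f) ^+ 2))
  <= lambda1 * Num.sqrt (rsum (fun i =>
         v i ^+ 2 * nrm (orth_proj (Z i) f) ^+ 2))
     + lambda2 * Num.sqrt (rsum (fun i =>
         v i ^+ 2 * nrm (orth_proj (V i) f) ^+ 2))
     + epsilon * nrm f ->
  forall A : {fset I},
    fl2 A (fun i => v i * nrm (orth_proj (Z i) f - orth_proj (V i) f))
    <= Num.sqrt B * (lambda1 + lambda2 + epsilon / Num.sqrt B) * nrm f.
Proof.
move=> l1 l2 B0 pert A; pose d i := nrm (orth_proj (Z i) f - orth_proj (V i) f).
(* Since [rsum] is 0 on divergent families, the hypothesis controls the finite sums only once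
   convergence is known; Minkowski and the two Bessel bounds provide it. *)
have fin : finite_sum (fun i => (v i * d i) ^+ 2).
  apply: (@finite_sum_fl2 _ _ _ (Num.sqrt B * nrm f + Num.sqrt B * nrm f)) => F.
  rewrite (le_trans _ (lerD (bessel_fl2 F f ZB) (bessel_fl2 F f VB)))//.
  rewrite (le_trans _ (fl2D _ _ _))// fl2_le// => i.
  rewrite mulr_ge0 ?nrm_ge0 ?(ltW (v0 i))//= -mulrDr.
  by rewrite ler_wpM2l ?(ltW (v0 i)) ?nrmB.
apply: (le_trans (fl2_le_rsum A fin)); rewrite -sqr_weight.
apply: (le_trans pert).
have := ler_wpM2l l1 (bessel_rsum f ZB).
have := ler_wpM2l l2 (bessel_rsum f VB).
have -> : Num.sqrt B * (lambda1 + lambda2 + epsilon / Num.sqrt B) * nrm f =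
   lambda1 * (Num.sqrt B * nrm f) + lambda2 * (Num.sqrt B * nrm f)
     + epsilon * nrm f.
  by field; rewrite gt_eqF// sqrtr_gt0.
by lra.
Qed.

Lemma frame_diff_bound h (c : R) : finite_sum (fun i => `|v i| ^+ 2) ->
  (forall A : {fset I},
    fl2 A (fun i => v i * nrm (orth_proj (Z i) h - orth_proj (V i) h)) <= c) ->
  nrm (frame_operator Z v h - frame_operator V v h) <=
    Num.sqrt (rsum (fun i => `|v i| ^+ 2)) * c.
Proof.
move=> fv hc; rewrite addrC -scaleN1r.
apply: has_sum_nrm_le (has_sum_lin (-1) (frame_has_sum VB h)
  (frame_has_sum ZB h)) _ => A.
have nonneg i : 0 <= v i * nrm (orth_proj (Z i) h - orth_proj (V i) h).
  by rewrite mulr_ge0 ?nrm_ge0 ?(ltW (v0 i)).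
(* The weight [v i ^+ 2] is split: one factor goes with the square-summable weights, the other with
   the projection difference. *)
apply: (@le_trans _ _ (\sum_(i <- A)
    `|v i| * (v i * nrm (orth_proj (Z i) h - orth_proj (V i) h)))).
  elim/big_rec2: _ => [|i x y _ yx]; first by rewrite nrm0.
  rewrite (le_trans (nrmD _ _))// lerD// scaleN1r addrC -scalerBr nrmZr normrX.
  by rewrite expr2 -mulrA ler_wpM2l// ler_wpM2r ?nrm_ge0//
    ger0_norm ?(ltW (v0 i)).
rewrite (le_trans (cauchy_schwarz_sum _ _ _))// ler_pM ?fl2_ge0//.
exact: fl2_le_rsum.
Qed.

Variables (W : I -> closed_subspace H) (U1 U2 : H -> H) (Lam mu u s z : R).
Hypotheses (lU1 : linear U1) (lU2 : linear U2).
Hypotheses (U12 : nrm_bound (U1 \- U2) mu) (U2u : nrm_bound U2 u).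
Hypotheses (Lam0 : 0 <= Lam) (s0 : 0 <= s) (z0 : 0 <= z).
Local Notation SV := (frame_operator V v).
Local Notation SZ := (frame_operator Z v).
Hypotheses (lV : linear (opinv SV)) (bV : nrm_bound (opinv SV) s).
Hypotheses (lZ : linear (opinv SZ)) (bZ : nrm_bound (opinv SZ) z).
Hypotheses (KV : cancel SV (opinv SV)) (KZ : cancel (opinv SZ) SZ).
Hypothesis fv : finite_sum (fun i => `|v i| ^+ 2).
Hypothesis ZV : forall f (A : {fset I}),
  fl2 A (fun i => v i * nrm (orth_proj (Z i) f - orth_proj (V i) f))
  <= Num.sqrt B * Lam * nrm f.

(** This rests on the resolvent identity [S_V^-1 - S_Z^-1 = S_V^-1 (S_Z - S_V) S_Z^-1]. *)
Lemma opinv_frame_diff f : nrm (opinv SV f - opinv SZ f) <=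
  s * (Num.sqrt (rsum (fun i => `|v i| ^+ 2))
    * (Num.sqrt B * Lam * (z * nrm f))).
Proof.
set h := opinv SZ f.
have -> : opinv SV f - h = opinv SV (SZ h - SV h) by rewrite (linB lV) KV /h KZ.
rewrite (le_trans (bV _))// ler_wpM2l//.
rewrite (le_trans (frame_diff_bound fv (ZV h)))// ler_wpM2l ?sqrtr_ge0//.
rewrite ler_wpM2l ?mulr_ge0 ?sqrtr_ge0//; exact: bZ.
Qed.

Lemma gram_factor_diff :
  nrm_bound (fun g => phi_op W V v (analysis_op V v (U1 g))
                      - phi_op W Z v (analysis_op Z v (U2 g)))
    (Num.sqrt B * s * (mu + Lam *
       (Num.sqrt B * z * Num.sqrt (rsum (fun i => `|v i| ^+ 2)) * u + u))).
Proof.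
move=> g; set N := Num.sqrt (rsum _); apply: nrm_ell2_le => A.
pose a1 i := v i * nrm (orth_proj (V i) ((U1 \- U2) g)).
pose a2 i := v i * nrm (orth_proj (Z i) (U2 g) - orth_proj (V i) (U2 g)).
pose a3 i := v i * nrm (orth_proj (Z i) (U2 g)).
(* [c3] is the bound of [opinv_frame_diff] on [S_V^-1 - S_Z^-1]; [a1], [a2], [a3] are the weighted
   norms entering the three terms of the splitting. *)
pose c3 := s * (N * (Num.sqrt B * Lam * z)).
have c30 : 0 <= c3 by rewrite !mulr_ge0 ?sqrtr_ge0.
apply: (@le_trans _ _ (s * fl2 A a1 + s * fl2 A a2 + c3 * fl2 A a3)).
  rewrite -!fl2Z//; apply: le_trans (lerD (fl2D _ _ _) (lexx _)).
  apply: le_trans (fl2D _ _ _); apply: fl2_le => i; rewrite nrm_ge0/=.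
  rewrite -[X in nrm X]/(phi_op W V v _ i - phi_op W Z v _ i)
  (phiE _ bV s0) (phiE _ bZ z0) (analysisE VB) (analysisE ZB).
  rewrite -(linB (@orth_proj_linear _ _ _ (W i)))
    (le_trans (nrm_proj_le _ _))//.
  rewrite (linZ lV) (linZ lZ) -scalerBr nrmZr (ger0_norm (ltW (v0 i))).
  rewrite /a1 /a2 /a3 !(mulrCA _ (v i)) -!mulrDr ler_wpM2l ?(ltW (v0 i))//.
  set p := orth_proj (V i) (U1 g); set p' := orth_proj (V i) (U2 g).
  set q := orth_proj (Z i) (U2 g).
  have -> : orth_proj (V i) ((U1 \- U2) g) = p - p'.
    by rewrite /= (linB (@orth_proj_linear _ _ _ (V i))).
  have -> : opinv SV p - opinv SZ q =
      opinv SV (p - p') - opinv SV (q - p') + (opinv SV q - opinv SZ q).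
    by rewrite !(linB lV) opprB !subrKA.
  rewrite (le_trans (nrmD _ _))// lerD//.
    by rewrite (le_trans (nrmB _ _))// mulrDr lerD.
  by rewrite (le_trans (opinv_frame_diff _))// /c3 !mulrA.
have h1 : fl2 A a1 <= Num.sqrt B * (mu * nrm g).
  by rewrite (le_trans (bessel_fl2 A _ VB))// ler_wpM2l ?sqrtr_ge0.
have h2 : fl2 A a2 <= Num.sqrt B * Lam * (u * nrm g).
  by rewrite (le_trans (ZV _ A))// ler_wpM2l ?mulr_ge0 ?sqrtr_ge0.
have h3 : fl2 A a3 <= Num.sqrt B * (u * nrm g).
  by rewrite (le_trans (bessel_fl2 A _ ZB))// ler_wpM2l ?sqrtr_ge0.
have := ler_wpM2l s0 h1; have := ler_wpM2l s0 h2; have := ler_wpM2l c30 h3.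
move=> {}h3 {}h2 {}h1; apply: (le_trans (lerD (lerD h1 h2) h3)).
by rewrite le_eqVlt; apply/orP; left; apply/eqP; rewrite /c3; ring.
Qed.

End fusion_perturbation.

Unset Implicit Arguments.

Theorem theorem4p1 (R : realType) (k : scalars) (H : hilbertType R k)
    (H_separable : exists D : set H, countable D /\ dense D)
    (I : countType) (W V Z : I -> closed_subspace H) (v : I -> R)
    (U1 U2 : {linear H -> H})
    (U1_bounded : continuous U1) (U2_bounded : continuous U2)
    (B_W A_V B_V A_Z B_Z mu lambda1 lambda2 epsilon : R)
    (W_bessel : bessel_fusion W v B_W)
    (U12 : opnorm (U1 \- U2) < mu)
    (V_frame : fusion_frame V v A_V B_V)
    (Z_frame : fusion_frame Z v A_Z B_Z)
    (G_invertible : invertible_operator (cross_gram U1 W v V v))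
    (lambda1_ge0 : 0 <= lambda1) (lambda2_ge0 : 0 <= lambda2)
    (epsilon_gt0 : 0 < epsilon)
    (perturbation : forall f : H,
      Num.sqrt (rsum (fun i =>
        v i ^+ 2 * nrm (orth_proj (Z i) f - orth_proj (V i) f) ^+ 2))
      <= lambda1 * Num.sqrt (rsum (fun i =>
             v i ^+ 2 * nrm (orth_proj (Z i) f) ^+ 2))
         + lambda2 * Num.sqrt (rsum (fun i =>
             v i ^+ 2 * nrm (orth_proj (V i) f) ^+ 2))
         + epsilon * nrm f)
    (v_sumsq : (\esum_(i in [set: I]) (`|v i| ^+ 2)%:E < +oo)%E)
    (small : let B := Num.max B_W (Num.max B_V B_Z) in
      mu + (lambda1 + lambda2 + epsilon / Num.sqrt B)
           * (Num.sqrt B * opnorm (opinv (frame_operator Z v))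
                * Num.sqrt (rsum (fun i => `|v i| ^+ 2)) * opnorm U2
              + opnorm U2)
      < (opnorm (opinv (cross_gram U1 W v V v)))^-1
        / (B * opnorm (opinv (frame_operator V v)))) :
  invertible_operator (cross_gram U2 W v Z v).
Proof.
set B := Num.max B_W (Num.max B_V B_Z) in small.
cbv zeta in small; rewrite -/B in small.
have [AV0 AVB VB0 _] := V_frame; have [_ _ ZB0 _] := Z_frame.
(* All three Bessel bounds are relaxed to the common [B]; the frame operators are inverted below
   with the original frame bounds. *)
have WB : bessel_fusion W v B by apply: bessel_fusion_mono W_bessel;
  rewrite le_max lexx.
have VB : bessel_fusion V v B by apply: bessel_fusion_mono VB0;
  rewrite !le_max lexx orbT.
have ZB : bessel_fusion Z v B by apply: bessel_fusion_mono ZB0;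
  rewrite !le_max lexx !orbT.
have B0 : 0 < B by rewrite (lt_le_trans AV0)// (le_trans AVB)//
  !le_max lexx orbT.
have sB : 0 < Num.sqrt B by rewrite sqrtr_gt0.
have [lV [CV bV] KV KV'] := frame_opinv V_frame.
have [lZ [CZ bZ] KZ KZ'] := frame_opinv Z_frame.
have lU1 : linear U1 by move=> ? ? ?; exact: linearP.
have lU2 : linear U2 by move=> ? ? ?; exact: linearP.
have lU : linear (U1 \- U2).
  by move=> c x y /=; rewrite lU1 lU2 scalerBr opprD addrACA.
have [m1 m10 bU1] := continuous_bound lU1 U1_bounded.
have [m2 m20 bU2] := continuous_bound lU2 U2_bounded.
have bU : nrm_bound (U1 \- U2) (m1 + m2).
  by move=> x; rewrite /= (le_trans (nrmB _ _))// mulrDl lerD.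
have mu0 : 0 < mu := le_lt_trans (opnorm_ge0 bU) U12.
have bmu : nrm_bound (U1 \- U2) mu.
  move=> x; rewrite (le_trans (opnorm_bound lU bU x))// ler_wpM2r ?nrm_ge0//.
  exact: ltW.
have [[lG cG] [S [[lS cS] GS SG]]] := G_invertible.
have [mS mS0 bS] := continuous_bound lS cS.
(* The chosen inverse map coincides with the bounded inverse [S], so the smallness hypothesis speaks
   of [opnorm S]. *)
rewrite (opinvE GS SG) in small.
set Lam := lambda1 + lambda2 + _ in small.
have Lam0 : 0 <= Lam by rewrite !addr_ge0// divr_ge0 ?ltW.
set sV := opnorm (opinv (frame_operator V v)) in small.
set sZ := opnorm (opinv (frame_operator Z v)) in small.
set u := opnorm U2 in small; set c := opnorm S in small.
set n := Num.sqrt (rsum _) in small.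
set rho := mu + _ in small.
have sV0 : 0 <= sV := opnorm_ge0 bV.
have sZ0 : 0 <= sZ := opnorm_ge0 bZ.
have u0 : 0 <= u := opnorm_ge0 bU2.
have c0 : 0 <= c := opnorm_ge0 bS.
have n0 : 0 <= n by exact: sqrtr_ge0.
have rho0 : 0 < rho.
  by rewrite ltr_wpDr// mulr_ge0// addr_ge0// !mulr_ge0// ltW.
have rhs0 := lt_trans rho0 small.
(* As inversion sends 0 to 0, a vanishing [c] or [sV] would make the right-hand side of [small]
   zero, against its positivity. *)
have cN0 : c != 0.
  by apply: contraTneq rhs0 => ->; rewrite invr0 mul0r ltxx.
have sVN0 : sV != 0.
  by apply: contraTneq rhs0 => ->; rewrite mulr0 invr0 mulr0 ltxx.
have sVp : 0 < sV by rewrite lt_def sVN0.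
have cp : 0 < c by rewrite lt_def cN0.
pose A g : ell2 W := phi_op W V v (analysis_op V v (U1 g))
  - phi_op W Z v (analysis_op Z v (U2 g)).
have bA : nrm_bound A (Num.sqrt B * sV * rho).
  apply: gram_factor_diff => //.
  - exact: (opnorm_bound lU2 bU2).
  - exact: (opnorm_bound lV bV).
  - exact: (opnorm_bound lZ bZ).
  - by move=> f F; apply: perturbation_fl2.
have lA : linear A.
  move=> a x y; rewrite /A lU1 lU2 (analysis_linear VB) (analysis_linear ZB).
  rewrite (phi_linear W lV (opnorm_bound lV bV) sV0).
  rewrite (phi_linear W lZ (opnorm_bound lZ bZ) sZ0).
  by rewrite scalerBr opprD addrACA.
have -> : cross_gram U2 W v Z v =
    (fun f => cross_gram U1 W v V v f - A (synthesis_op W v f)).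
  by apply/funext => f; rewrite /A /cross_gram opprB addrC subrK.
apply: (invertible_factored_perturbation lG cG lS GS SG (synthesis_linear WB) lA
  (opnorm_bound lS bS) (synthesis_bound WB) bA) => //.
- by rewrite !mulr_ge0// ltW.
(* One [Num.sqrt B] comes from the bound on [A], the other from the synthesis operator; together
   they form the [B] in the denominator of [small]. *)
have -> : opnorm S * (Num.sqrt B * sV * rho) * Num.sqrt B =
    rho * (c * (Num.sqrt B ^+ 2 * sV)) by rewrite /c; ring.
rewrite sqr_sqrtr ?(ltW B0)// -ltr_pdivlMr ?mulr_gt0// mul1r invfM.
exact: small.
Qed.
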